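(* Let $f,h,g$ satisfy the standing assumptions (A1)–(A5) of the context, and let $L_h>0$ be the Lipschitz constant of $\nabla h$ in (A2). Suppose in addition that: (1) $f$ is locally Lipschitz continuous on $\mathrm{dom}\,f$, i.e., for any $\bm{x}\in\mathrm{dom}\,f$ there exist a neighborhood $\mathcal{O}$ of $\bm{x}$ and a constant $L_x>0$ such that $|f(\bm{u})-f(\bm{v})|\le L_x\|\bm{u}-\bm{v}\|$ for all $\bm{u},\bm{v}\in\mathcal{O}\cap\mathrm{dom}\,f$; (2) $g$ is continuously differentiable on $\Omega$ with a locally Lipschitz continuous gradient; (3) $\{\bm{x}^k\}$ is a sequence generated by the iVPGSA described in the context, and there exists an integer $K_0>0$ such that $\delta_k=0$ for all $k\ge K_0$; (4) there exist $\underline{\gamma},\overline{\gamma}>0$ such that $\frac{L_h}{2}<\underline{\gamma}\le\overline{\gamma}$ and $\underline{\gamma}I_n\preceq H_k\preceq\overline{\gamma}I_n$ for all $k\ge0$. Let $\tau>1$. If the function $\Phi_\tau(\bm{x},t):=F(\bm{x})+\frac{t^\tau}{\tau}$, $(\bm{x},t)\in\mathrm{dom}\,F\times\mathbb{R}_+$, is a KL function and $$\sum_{k=0}^{\infty}\varepsilon_k<+\infty,\qquad \sum_{k=0}^{\infty}\sqrt{\varepsilon_k}<+\infty,\qquad \sum_{k=0}^{\infty}\Big(\sum_{i=k}^{\infty}\varepsilon_i\Big)^{1-\frac1\tau}<+\infty,$$ then $\{\bm{x}^k\}$ converges to a critical point of $F$.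
   Context: Notation. $\|\cdot\|$ is the Euclidean norm; $I_n$ is the $n\times n$ identity; $\preceq$ is the Loewner order. For a proper closed convex function $f$, $\delta\ge 0$ and $\bm{x}\in\mathrm{dom}\,f$, $\partial_\delta f(\bm{x}):=\{\bm{d}: f(\bm{y})\ge f(\bm{x})+\langle \bm{d},\bm{y}-\bm{x}\rangle-\delta\ \ \forall \bm{y}\in\mathbb{R}^n\}$, and $\partial f=\partial_0 f$. For a general proper closed function $\psi$, $\partial\psi$ is the limiting subdifferential: $\widehat\partial\psi(\bm{x}):=\{\bm{d}:\liminf_{\bm{y}\to\bm{x},\bm{y}\ne\bm{x}}\frac{\psi(\bm{y})-\psi(\bm{x})-\langle\bm{d},\bm{y}-\bm{x}\rangle}{\|\bm{y}-\bm{x}\|}\ge0\}$, and $\partial\psi(\bm{x})$ is the set of limits of $\bm{d}^k\in\widehat\partial\psi(\bm{x}^k)$ with $\bm{x}^k\to\bm{x}$ and $\psi(\bm{x}^k)\to\psi(\bm{x})$. Problem. Consider $\min_{\bm{x}\in\Omega}\frac{f(\bm{x})+h(\bm{x})}{g(\bm{x})}$, where $\Omega:=\{\bm{x}\in\mathbb{R}^n: g(\bm{x})\neq0\}$ is nonempty, and define $F(\bm{x}):=\frac{f(\bm{x})+h(\bm{x})}{g(\bm{x})}$ if $\bm{x}\in\mathrm{dom}\,f\cap\Omega$, and $F(\bm{x}):=+\infty$ otherwise. Standing assumptions. (A1) $f:\mathbb{R}^n\to\mathbb{R}\cup\{+\infty\}$ is proper, closed and convex. (A2) $h:\mathbb{R}^n\to\mathbb{R}$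 is continuously differentiable (possibly nonconvex) and there is $L_h>0$ with $\|\nabla h(\bm{x})-\nabla h(\bm{y})\|\le L_h\|\bm{x}-\bm{y}\|$ for all $\bm{x},\bm{y}$. (A3) $g:\mathbb{R}^n\to\mathbb{R}$ is continuous, convex, and nonnegative over $\mathrm{dom}\,f$. (A4) $f+h$ is nonnegative on $\mathrm{dom}\,f$, and $f(\bm{x})+h(\bm{x})>0$ when $g(\bm{x})=0$. (A5) $F$ is level-bounded: for every $\alpha\in\mathbb{R}$ the set $\{\bm{x}:F(\bm{x})\le\alpha\}$ is bounded (possibly empty). Algorithm (iVPGSA). Input: $\bm{x}^0\in\Omega\cap\mathrm{dom}\,f$, nonnegative scalars $\{\varepsilon_k\}_{k\ge0}$, symmetric positive definite matrices $\{H_k\}_{k\ge0}\subset\mathbb{R}^{n\times n}$. For each $k=0,1,2,\dots$: set $c_k=\frac{f(\bm{x}^k)+h(\bm{x}^k)}{g(\bm{x}^k)}$ and take any $\bm{y}^k\in\partial g(\bm{x}^k)$; find $\bm{x}^{k+1}\in\Omega\cap\mathrm{dom}\,f$ and an error pair $(\Delta^k,\delta_k)\in\mathbb{R}^n\times[0,\infty)$ such that $$\Delta^k\in\partial_{\delta_k}f(\bm{x}^{k+1})+\nabla h(\bm{x}^k)-c_k\bm{y}^k+H_k(\bm{x}^{k+1}-\bm{x}^k)$$ and $$\|\Delta^k\|^2+|\langle\Delta^k,\bm{x}^{k+1}-\bm{x}^k\rangle|+\delta_k\le\varepsilon_k\,g(\bm{x}^{k+1}).$$ The generated sequence $\{\bm{x}^k\}_{k\ge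 0}$ is infinite. Critical point. $\bm{x}^*\in\mathrm{dom}\,F$ is a critical point of $F$ if, with $c^*=F(\bm{x}^* )$, $0\in\partial f(\bm{x}^* )+\nabla h(\bm{x}^* )-c^*\partial g(\bm{x}^* )$. KL function. For $\nu\in(0,+\infty]$ let $\Xi_\nu$ be the class of concave $\varphi:[0,\nu)\to\mathbb{R}_+$ with $\varphi(0)=0$, $\varphi$ continuously differentiable on $(0,\nu)$ and continuous at $0$, and $\varphi'>0$ on $(0,\nu)$. A proper closed function $\psi:\mathbb{R}^N\to\mathbb{R}\cup\{+\infty\}$ has the KL property at $\tilde{\bm{x}}\in\mathrm{dom}\,\partial\psi:=\{\bm{x}:\partial\psi(\bm{x})\ne\emptyset\}$ if there are $\nu\in(0,+\infty]$, a neighborhood $\mathcal{V}$ of $\tilde{\bm{x}}$ and $\varphi\in\Xi_\nu$ such that $\varphi'(\psi(\bm{x})-\psi(\tilde{\bm{x}}))\,\mathrm{dist}(0,\partial\psi(\bm{x}))\ge1$ for all $\bm{x}\in\mathcal{V}$ with $\psi(\tilde{\bm{x}})<\psi(\bm{x})<\psi(\tilde{\bm{x}})+\nu$. $\psi$ is a KL function if it has the KL property at every point of $\mathrm{dom}\,\partial\psi$. Here $\Phi_\tau$ is regarded as a function on $\mathbb{R}^{n}\times\mathbb{R}$ equal to $+\infty$ outside $\mathrm{dom}\,F\times\mathbb{R}_+$. *)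

(* Defs.v *)
(* Vectors of R^n are row vectors 'rV[R]_n. The library norm
   `|x| on 'rV[R]_n is the sup norm; it is used only through the topology, the
   notion of differentiability and bounded_set, none of which depends on the
   choice of norm. Every quantitative estimate uses the Euclidean norm enorm. *)
From HB Require Import structures.
From mathcomp Require Import all_boot all_order all_algebra.
From mathcomp Require Import all_classical all_reals all_analysis.

Set Implicit Arguments.
Unset Strict Implicit.
Unset Printing Implicit Defensive.

Import Order.TTheory GRing.Theory Num.Theory.
Import numFieldNormedType.Exports.

Local Open Scope classical_set_scope.
Local Open Scope ring_scope.

Definition dot (R : realType) (n : nat) (u v : 'rV[R]_n) : R :=
  \sum_(i < n) u 0 i * v 0 i.

Definition enorm (R : realType) (n : nat) (u : 'rV[R]_n) : R :=
  Num.sqrt (dot u u).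

(* Since vectors are rows, M acts by v |-> v *m M; for the symmetric matrices
   considered here this is the usual product M v. *)
Definition sym_posdef (R : realType) (n : nat) (M : 'M[R]_n) : Prop :=
  M^T = M /\ forall v : 'rV[R]_n, v != 0 -> 0 < dot (v *m M) v.

Definition sym_possemidef (R : realType) (n : nat) (M : 'M[R]_n) : Prop :=
  M^T = M /\ forall v : 'rV[R]_n, 0 <= dot (v *m M) v.

Definition loewner_le (R : realType) (n : nat) (A B : 'M[R]_n) : Prop :=
  sym_possemidef (B - A).

(* The vector of partial derivatives; it is the gradient of f at x wherever f
   is differentiable at x, which is required by C1_on below. *)
Definition grad (R : realType) (n : nat) (f : 'rV[R]_n -> R) (x : 'rV[R]_n) :
  'rV[R]_n := \row_(i < n) 'D_(delta_mx 0 i) f x.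

(* To be used for open A. *)
Definition C1_on (R : realType) (n : nat) (A : set 'rV[R]_n)
    (f : 'rV[R]_n -> R) : Prop :=
  forall x, A x -> differentiable f x /\ {for x, continuous (grad f)}.

Definition effdom (R : realType) (n : nat) (f : 'rV[R]_n -> \bar R) :
  set 'rV[R]_n := [set x | (f x < +oo)%E].

Definition eproper (R : realType) (n : nat) (f : 'rV[R]_n -> \bar R) : Prop :=
  (forall x, (-oo < f x)%E) /\ effdom f !=set0.

(* Closedness of an extended-real-valued function is lower_semicontinuous. *)

Definition econvex (R : realType) (n : nat) (f : 'rV[R]_n -> \bar R) : Prop :=
  forall (x y : 'rV[R]_n) (t : R), 0 < t < 1 ->
    (f (t *: x + (1 - t) *: y)%R <= t%:E * f x + (1 - t)%:E * f y)%E.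

Definition eps_subdiff (R : realType) (n : nat) (delta : R)
    (f : 'rV[R]_n -> \bar R) (x : 'rV[R]_n) : set 'rV[R]_n :=
  [set d | effdom f x /\
    forall y, (f x + (dot d (y - x))%:E - delta%:E <= f y)%E].

Definition convex_subdiff (R : realType) (n : nat)
    (f : 'rV[R]_n -> \bar R) (x : 'rV[R]_n) : set 'rV[R]_n :=
  eps_subdiff 0 f x.

(* Both generalized subdifferentials are empty outside the effective domain. *)
Definition frechet_subdiff (R : realType) (n : nat)
    (psi : 'rV[R]_n -> \bar R) (x : 'rV[R]_n) : set 'rV[R]_n :=
  [set d | effdom psi x /\
    (0 <= limf_einf (fun y : 'rV[R]_n =>
            (psi y - psi x - (dot d (y - x)%R)%:E)
              * ((enorm (y - x)%R)^-1)%:E) x^')%E].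

Definition limiting_subdiff (R : realType) (n : nat)
    (psi : 'rV[R]_n -> \bar R) (x : 'rV[R]_n) : set 'rV[R]_n :=
  [set d | effdom psi x /\
    exists (xs ds : nat -> 'rV[R]_n),
      [/\ forall k, frechet_subdiff psi (xs k) (ds k),
          xs @ \oo --> x,
          psi (xs k) @[k --> \oo] --> psi x &
          ds @ \oo --> d]].

(* dist(0, S), equal to +oo for empty S. *)
Definition dist0 (R : realType) (n : nat) (S : set 'rV[R]_n) : \bar R :=
  ereal_inf [set (enorm d)%:E | d in S].

(* The class Xi_nu; phi is a total function of which only the values on
   [0, nu) matter. *)
Definition desingularizing (R : realType) (nu : \bar R) (phi : R -> R) : Prop :=
  [/\ convex_function (E := R^o) [set s : R | 0 <= s /\ (s%:E < nu)%E]
        (fun s => - phi s),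
      phi 0 = 0,
      forall s : R, 0 <= s -> (s%:E < nu)%E -> 0 <= phi s,
      phi s @[s --> 0^'+] --> phi 0 &
      forall s : R, 0 < s -> (s%:E < nu)%E ->
        [/\ derivable phi s 1, {for s, continuous (derive1 phi)} & 0 < derive1 phi s]].

Definition KL_property (R : realType) (n : nat) (psi : 'rV[R]_n -> \bar R)
    (xt : 'rV[R]_n) : Prop :=
  exists (nu : \bar R) (V : set 'rV[R]_n) (phi : R -> R),
    [/\ (0 < nu)%E, nbhs xt V, desingularizing nu phi &
      forall x, V x -> (psi xt < psi x)%E -> (psi x < psi xt + nu)%E ->
        (1 <= (derive1 phi (fine (psi x) - fine (psi xt))%R)%:E
               * dist0 (limiting_subdiff psi x))%E].

Definition KL_function (R : realType) (n : nat) (psi : 'rV[R]_n -> \bar R) :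
    Prop :=
  [/\ eproper psi, lower_semicontinuous psi &
    forall x, limiting_subdiff psi x !=set0 -> KL_property psi x].

Definition Omega (R : realType) (n : nat) (g : 'rV[R]_n -> R) :
  set 'rV[R]_n := [set x | g x != 0].

(* (f + h) / g as a real number; meaningful on effdom f `&` Omega g. *)
Definition ratio (R : realType) (n : nat) (f : 'rV[R]_n -> \bar R)
    (h g : 'rV[R]_n -> R) (x : 'rV[R]_n) : R :=
  (fine (f x) + h x) / g x.

Definition objF (R : realType) (n : nat) (f : 'rV[R]_n -> \bar R)
    (h g : 'rV[R]_n -> R) (x : 'rV[R]_n) : \bar R :=
  if `[< effdom f x /\ Omega g x >] then (ratio f h g x)%:E else +oo%E.

Definition level_bounded (R : realType) (n : nat) (F : 'rV[R]_n -> \bar R) :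
    Prop :=
  forall alpha : R, bounded_set [set x | (F x <= alpha%:E)%E].

(* R^n x R is 'rV[R]_(n + 1), the last coordinate being t. *)
Definition Phi (R : realType) (n : nat) (F : 'rV[R]_n -> \bar R) (tau : R)
    (z : 'rV[R]_(n + 1)) : \bar R :=
  let x := lsubmx z in
  let t := rsubmx z 0 0 in
  if 0 <= t then (F x + ((t `^ tau)%R / tau)%:E)%E else +oo%E.

Definition critical_point (R : realType) (n : nat) (f : 'rV[R]_n -> \bar R)
    (h g : 'rV[R]_n -> R) (xs : 'rV[R]_n) : Prop :=
  effdom (objF f h g) xs /\
  exists (u v : 'rV[R]_n),
    [/\ convex_subdiff f xs u, convex_subdiff (EFin \o g) xs v &
        0 = u + grad h xs - fine (objF f h g xs) *: v].

(* The infinite sequence x, together with the selected subgradients y and the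
   error pairs (Delta, delta), is a run of the algorithm with tolerances eps
   and metrics H. *)
Definition iVPGSA (R : realType) (n : nat) (f : 'rV[R]_n -> \bar R)
    (h g : 'rV[R]_n -> R) (eps : nat -> R) (H : nat -> 'M[R]_n)
    (x y Delta : nat -> 'rV[R]_n) (delta : nat -> R) : Prop :=
  [/\ forall k, 0 <= eps k,
      forall k, sym_posdef (H k),
      forall k, Omega g (x k) /\ effdom f (x k),
      forall k, convex_subdiff (EFin \o g) (x k) (y k) &
      forall k,
        [/\ 0 <= delta k,
            exists2 xi, eps_subdiff (delta k) f (x k.+1) xi &
              Delta k = xi + grad h (x k) - ratio f h g (x k) *: y k
                        + (x k.+1 - x k) *m H k &
            enorm (Delta k) ^+ 2 + `|dot (Delta k) (x k.+1 - x k)| + delta k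
              <= eps k * g (x k.+1)]].

Definition locally_lipschitz_on (R : realType) (n m : nat)
    (A : set 'rV[R]_n) (G : 'rV[R]_n -> 'rV[R]_m) : Prop :=
  forall x, A x -> exists (O : set 'rV[R]_n) (L : R),
    [/\ nbhs x O, 0 < L &
      forall u v, (O `&` A) u -> (O `&` A) v ->
        enorm (G u - G v) <= L * enorm (u - v)].

Definition locally_lipschitz_on_dom (R : realType) (n : nat)
    (f : 'rV[R]_n -> \bar R) : Prop :=
  forall x, effdom f x -> exists (O : set 'rV[R]_n) (L : R),
    [/\ nbhs x O, 0 < L &
      forall u v, (O `&` effdom f) u -> (O `&` effdom f) v ->
        `|fine (f u) - fine (f v)| <= L * enorm (u - v)].

(* Main.v *)
Require Import Defs.
From HB Require Import structures.
From mathcomp Require Import all_boot all_order all_algebra.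
From mathcomp Require Import all_classical all_reals all_analysis.
From mathcomp Require Import ring lra zify.

Set Implicit Arguments.
Unset Strict Implicit.
Unset Printing Implicit Defensive.

Import Order.TTheory GRing.Theory Num.Theory.
Import numFieldNormedType.Exports.

Local Open Scope classical_set_scope.
Local Open Scope ring_scope.

(** Write [c k] for the objective value [F (x k)], [d k] for the step length
    [|x k.+1 - x k|], [s k] for the tail [\sum_(i >= k) eps i], and
    [t k := (tau * s k) `^ tau^-1], so that
    [Phi (x k, t k) = c k + s k].

    - Decrease. The approximate optimality condition, the convexity of [f] and
      [g], and the descent lemma for [h] give
      [c k.+1 + (gl - Lh / 2) / g (x k.+1) * d k ^+ 2 <= c k + eps k]
      ([descent_step]). Hence [c k + s k] is nonincreasing, the iterates stay in a
      level set of [F], which is bounded, and [c] converges to some [cs] while [d]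
      tends to [0] ([merit_run_limit], [step_run_cvg0]).

    - Cluster points. Let [u] be a limit of a subsequence. Lower semicontinuity
      bounds [f u] by [cs * g u - h u], so [u] is in the domain of [f], and
      [g u = 0] is excluded because [f + h] is positive there. By local Lipschitz
      continuity of [f], [F u = cs]. The graph of the convex subdifferential is
      closed and the errors vanish, so [u] is critical ([cluster_critical]).

    - Subgradients of the potential. A subgradient of [f] yields a Frechet
      subgradient of [Phi] by the quotient rule in the first variable and Young's
      inequality in the second ([frechet_subdiff_Phi]). Near [u] the functions
      [F], [grad g] and [grad h] are Lipschitz along the iterates, so the
      norm of this subgradient at [(x k.+1, t k.+1)] is at most a multiple of
      [d k + Num.sqrt (eps k) + s k.+1 `^ (1 - tau^-1)] ([subgrad_run_le]). The
      hypotheses on [eps] make the last two terms summable.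

    - Length of the path. The Kurdyka-Lojasiewicz inequality at [(u, 0)], the
      concavity of the desingularizing function and the arithmetic-geometric
      mean inequality bound [2 * d k.+1] by a telescoping term plus
      [d k] plus a summable term as long as the iterates are near [u] ([kl_step]).
      An iterate far enough in the subsequence then traps all later ones in an
      arbitrarily small ball around [u] ([capture_cvg]), so the whole sequence
      converges to [u]. *)

(** * Euclidean structure on row vectors *)

Section Dot.
Variables (R : realType) (n : nat).
Implicit Types (u v w : 'rV[R]_n) (a : R).

Lemma dotC u v : dot u v = dot v u.
Proof. by apply: eq_bigr => i _; rewrite mulrC. Qed.

Lemma dotDl u v w : dot (u + v) w = dot u w + dot v w.
Proof. by rewrite -big_split; apply: eq_bigr => i _; rewrite mxE mulrDl. Qed.

Lemma dotZl a u v : dot (a *: u) v = a * dot u v.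
Proof. by rewrite mulr_sumr; apply: eq_bigr => i _; rewrite mxE mulrA. Qed.

Lemma dotNl u v : dot (- u) v = - dot u v.
Proof. by rewrite -scaleN1r dotZl mulN1r. Qed.

Lemma dotBl u v w : dot (u - v) w = dot u w - dot v w.
Proof. by rewrite dotDl dotNl. Qed.

Lemma dotDr u v w : dot w (u + v) = dot w u + dot w v.
Proof. by rewrite dotC dotDl !(dotC w). Qed.

Lemma dotZr a u v : dot v (a *: u) = a * dot v u.
Proof. by rewrite dotC dotZl (dotC v). Qed.

Lemma dotNr u v : dot v (- u) = - dot v u.
Proof. by rewrite dotC dotNl (dotC v). Qed.

Lemma dot0l v : dot 0 v = 0.
Proof. by apply: big1 => i _; rewrite mxE mul0r. Qed.

Lemma dot0r v : dot v 0 = 0.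
Proof. by rewrite dotC dot0l. Qed.

Lemma dot_ge0 u : 0 <= dot u u.
Proof. by apply: sumr_ge0 => i _; rewrite -expr2 sqr_ge0. Qed.

Lemma dot_mulmx u v (M : 'M[R]_n) : dot (u *m M) v = dot u (v *m M^T).
Proof.
have dotE p q : dot p q = (p *m q^T) 0 0.
  by rewrite mxE; apply: eq_bigr => i _; rewrite [q^T _ _]mxE.
by rewrite !dotE trmx_mul trmxK mulmxA.
Qed.

(** Cauchy-Schwarz inequality for the semi-inner product defined by [M]. *)
Lemma psd_cauchy_schwarz (M : 'M[R]_n) u v : sym_possemidef M ->
  dot (u *m M) v ^+ 2 <= dot (u *m M) u * dot (v *m M) v.
Proof.
move=> [Msym Mpos].
have Hsym : dot (v *m M) u = dot (u *m M) v.
  by rewrite dot_mulmx Msym dotC.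
have pos s t : 0 <= s ^+ 2 * dot (u *m M) u + 2 * s * t * dot (u *m M) v
                    + t ^+ 2 * dot (v *m M) v.
  have := Mpos (s *: u + t *: v).
  rewrite mulmxDl -!scalemxAl !(dotDl, dotDr, dotZl, dotZr) Hsym.
  by congr (_ <= _); ring.
move: (Mpos u) (Mpos v) pos.
move: (dot (u *m M) u) (dot (u *m M) v) (dot (v *m M) v) => A B C A0 C0 pos.
have [A_gt0|A_le0] := ltP 0 A.
  have := pos (- B) A; rewrite -subr_ge0 => p.
  have : 0 <= A * (A * C - B ^+ 2) by apply: le_trans p _; nra.
  by rewrite pmulr_rge0// subr_ge0.
have A_eq0 : A = 0 by apply/eqP; rewrite eq_le A_le0.
(* a degenerate form: a large multiple of [u] forces the mixed term to vanish *)
rewrite A_eq0 mul0r in pos *.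
have [->|B0] := eqVneq B 0; first by rewrite expr0n.
have := pos (- (C + 1) / (2 * B)) 1.
have -> : 2 * (- (C + 1) / (2 * B)) * 1 * B = - (C + 1) by field.
lra.
Qed.

Lemma dot_cauchy_schwarz u v : dot u v ^+ 2 <= dot u u * dot v v.
Proof.
have id_psd : sym_possemidef (1%:M : 'M[R]_n).
  by split => [|w]; [rewrite trmx1 | rewrite mulmx1 dot_ge0].
by have := psd_cauchy_schwarz u v id_psd; rewrite !mulmx1.
Qed.

Lemma enorm_ge0 u : 0 <= enorm u.
Proof. exact: sqrtr_ge0. Qed.

Lemma sqr_enorm u : enorm u ^+ 2 = dot u u.
Proof. by rewrite sqr_sqrtr ?dot_ge0. Qed.

Lemma enorm0 : enorm (0 : 'rV[R]_n) = 0.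
Proof. by rewrite /enorm dot0l sqrtr0. Qed.

Lemma enormN u : enorm (- u) = enorm u.
Proof. by rewrite /enorm dotNl dotNr opprK. Qed.

Lemma enormB u v : enorm (u - v) = enorm (v - u).
Proof. by rewrite -enormN opprB. Qed.

Lemma enormZ a u : enorm (a *: u) = `|a| * enorm u.
Proof.
rewrite /enorm dotZl dotZr mulrA -expr2 sqrtrM ?sqr_ge0//.
by rewrite sqrtr_sqr.
Qed.

Lemma abs_dot_le u v : `|dot u v| <= enorm u * enorm v.
Proof.
rewrite -(@ler_pXn2r _ 2) ?nnegrE ?mulr_ge0 ?enorm_ge0//.
by rewrite exprMn !sqr_enorm real_normK ?num_real// dot_cauchy_schwarz.
Qed.

Lemma dot_le_enorm u v : dot u v <= enorm u * enorm v.
Proof. exact: le_trans (ler_norm _) (abs_dot_le _ _). Qed.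

Lemma enormD u v : enorm (u + v) <= enorm u + enorm v.
Proof.
rewrite -(@ler_pXn2r _ 2) ?nnegrE ?addr_ge0 ?enorm_ge0//.
rewrite sqr_enorm dotDl !dotDr sqrrD !sqr_enorm (dotC v u).
by have := dot_le_enorm u v; lra.
Qed.

Lemma enorm_triangle v u w : enorm (u - w) <= enorm (v - w) + enorm (u - v).
Proof.
have -> : u - w = (v - w) + (u - v) by rewrite [RHS]addrC addrA subrK.
exact: enormD.
Qed.

Lemma enormBD u v : enorm (u - v) <= enorm u + enorm v.
Proof. by rewrite -(enormN v) enormD. Qed.

Lemma norm_le_enorm u : `|u| <= enorm u.
Proof.
rewrite /Num.norm /= mx_normrE; apply: bigmax_le => /=; first exact: enorm_ge0.
move=> [i j] _ /=; rewrite (ord1 i).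
rewrite -(@ler_pXn2r _ 2) ?nnegrE ?enorm_ge0//.
rewrite real_normK ?num_real// sqr_enorm /dot (bigD1 j)//= -expr2 lerDl.
by apply: sumr_ge0 => k _; rewrite -expr2 sqr_ge0.
Qed.

Lemma enorm_le_norm u : enorm u <= n%:R * `|u|.
Proof.
have le_coord i : `|u 0 i| <= `|u|.
  rewrite /Num.norm /= mx_normrE.
  exact: (le_bigmax _ (fun k : 'I_1 * 'I_n => `|u k.1 k.2|) (ord0, i)).
rewrite -(@ler_pXn2r _ 2) ?nnegrE ?mulr_ge0 ?enorm_ge0//.
rewrite sqr_enorm exprMn; apply: (@le_trans _ _ (n%:R * `|u| ^+ 2)).
  rewrite -[n in n%:R]card_ord mulr_natl -sumr_const.
  apply: ler_sum => i _; rewrite -expr2 -[u 0 i ^+ 2]real_normK ?num_real//.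
  by rewrite ler_pXn2r ?nnegrE.
rewrite ler_wpM2r ?sqr_ge0// -natrX ler_nat.
by case: (n) => [|m] //; rewrite -mulnn leq_pmulr.
Qed.

Lemma enorm_eq0 u : enorm u = 0 -> u = 0.
Proof.
by move=> u0; apply/eqP; rewrite -normr_le0 -u0 norm_le_enorm.
Qed.

(** Neighbourhoods are those of the Euclidean norm. *)
Lemma nbhs_enormP u (V : set 'rV[R]_n) :
  nbhs u V <-> exists2 e : R, 0 < e & forall v, enorm (v - u) < e -> V v.
Proof.
split.
  move/nbhs_ballP => [e /= e0 uV]; exists e => // v vu; apply: uV.
  by rewrite -ball_normE /= distrC (le_lt_trans (norm_le_enorm _)).
move=> [e e0 uV]; apply/nbhs_ballP.
exists (e / n.+1%:R) => /=; first by rewrite divr_gt0.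
move=> v; rewrite -ball_normE /= distrC => vu; apply: uV.
apply: le_lt_trans (enorm_le_norm _) _.
apply: (@le_lt_trans _ _ (n.+1%:R * `|v - u|)).
  by rewrite ler_wpM2r// ler_nat.
by rewrite mulrC -ltr_pdivlMr.
Qed.

Lemma cvg_enormP (x : nat -> 'rV[R]_n) u :
  x @ \oo --> u <-> enorm (x k - u) @[k --> \oo] --> 0.
Proof.
split => [xu|xu].
  apply/cvgrPdist_lt => e e0.
  have [d d0 ud] : exists2 d : R, 0 < d & forall v, enorm (v - u) < d ->
      enorm (v - u) < e by exists e.
  have /xu : nbhs u [set v | enorm (v - u) < e] by apply/nbhs_enormP; exists e.
  rewrite /nbhs /= => -[N _ NP]; exists N => // k /NP /=.
  by rewrite sub0r normrN ger0_norm ?enorm_ge0.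
move=> V /nbhs_enormP[e e0 eV].
move/cvgrPdist_lt : xu => /(_ _ e0)[N _ NP]; exists N => // k /NP /=.
by rewrite sub0r normrN ger0_norm ?enorm_ge0// => /eV.
Qed.

End Dot.

Lemma psd_norm_le (R : realType) (n : nat) (H : 'M[R]_n) (c : R) (u : 'rV[R]_n) :
  sym_posdef H -> loewner_le H c%:M -> 0 <= c -> enorm (u *m H) <= c * enorm u.
Proof.
move=> [Hs Hp] [_ HM] c0.
have Hpsd : sym_possemidef H.
  split => // v; have [->|v0] := eqVneq v 0; first by rewrite dot0r.
  exact/ltW/Hp.
have le_c v : dot (v *m H) v <= c * dot v v.
  by have := HM v; rewrite mulmxBr mul_mx_scalar dotBl dotZl subr_ge0.
have := psd_cauchy_schwarz u (u *m H) Hpsd; rewrite -sqr_enorm => cs.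
have [Hu0|Hu_gt0] := eqVneq (enorm (u *m H)) 0.
  by rewrite Hu0 mulr_ge0 ?enorm_ge0.
have {}Hu_gt0 : 0 < enorm (u *m H) by rewrite lt_def Hu_gt0 enorm_ge0.
rewrite -(@ler_pXn2r _ 2) ?nnegrE ?mulr_ge0 ?enorm_ge0//.
rewrite -(ler_pM2r (exprn_gt0 2 Hu_gt0)) -expr2; apply: le_trans cs _.
rewrite exprMn [in leRHS]sqr_enorm [in X in _ <= _ * X]sqr_enorm.
have -> : c ^+ 2 * dot u u * dot (u *m H) (u *m H)
        = (c * dot u u) * (c * dot (u *m H) (u *m H)) by ring.
by apply: ler_pM; rewrite ?le_c//; case: Hpsd => _; apply.
Qed.

(** * Gradients and subgradients *)

Section Gradient.
Variables (R : realType) (n : nat).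
Implicit Types (u v : 'rV[R]_n) (f h g : 'rV[R]_n -> R).

Lemma diff_grad f u v : differentiable f u -> 'd f u v = dot (grad f u) v.
Proof.
move=> df; rewrite [v in LHS]row_sum_delta linear_sum /=.
by apply: eq_bigr => i _; rewrite linearZ /= /grad !mxE deriveE// mulrC.
Qed.

Lemma derive_grad f u v : differentiable f u -> 'D_v f u = dot (grad f u) v.
Proof. by move=> df; rewrite deriveE// diff_grad. Qed.

(** First-order expansion in terms of the Euclidean norm. *)
Lemma differentiable_approx f u (e : R) : differentiable f u -> 0 < e ->
  exists2 d : R, 0 < d & forall v, enorm (v - u) < d ->
    `|f v - f u - dot (grad f u) (v - u)| <= e * enorm (v - u).
Proof.
move=> df e0.
have /eqaddoP/(_ _ e0) := diff_locally df.
rewrite near_simpl => /nbhs_enormP[d d0 dP].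
exists d => // v vu; have := dP (v - u); rewrite subr0 => /(_ vu) /=.
rewrite -[X in `|X| <= _ * `|_| -> _]/(f (v - u + u) - (f u + 'd f u (v - u))).
rewrite diff_grad// subrK opprD addrA => /le_trans; apply.
by rewrite ler_wpM2l ?norm_le_enorm// ltW.
Qed.

Lemma is_derive_line f u v (t : R) : differentiable f (t *: v + u) ->
  is_derive t 1 (fun s : R => f (s *: v + u)) (dot (grad f (t *: v + u)) v).
Proof.
move=> df.
have quotE : (fun h : R => h^-1 *: (f ((h *: (1 : R) + t) *: v + u) - f (t *: v + u)))
           = (fun h : R => h^-1 *: (f (h *: v + (t *: v + u)) - f (t *: v + u))).
  by apply/funext => s; rewrite [s *: 1]mulr1 scalerDl addrA.
split.
  by rewrite /derivable /= quotE; exact: diff_derivable.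
by rewrite /derive /= quotE -derive_grad.
Qed.

(** The descent lemma for a function with Lipschitz gradient. *)
Lemma descent_lemma h (L : R) u v : C1_on setT h -> 0 <= L ->
  (forall w z, enorm (grad h w - grad h z) <= L * enorm (w - z)) ->
  h v <= h u + dot (grad h u) (v - u) + L / 2 * enorm (v - u) ^+ 2.
Proof.
move=> hC1 L0 hL; set d := v - u.
pose k (t : R) := h (t *: d + u) - (dot (grad h u) d * t
                   + L / 2 * enorm d ^+ 2 * t ^+ 2).
pose dk (t : R) := dot (grad h (t *: d + u)) d - (dot (grad h u) d
                   + L * enorm d ^+ 2 * t).
have dkP (t : R) : is_derive t 1 k (dk t).
  have ? := @is_derive_line h u d t (hC1 _ I).1.
  rewrite /k /dk; apply: is_derive_eq.
  by rewrite /GRing.scale /=; congr (_ - _); field.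
have [c] : exists2 c, c \in `]0, 1[%R & k 1 - k 0 = dk c * (1 - 0).
  apply: MVT => //; apply: continuous_subspaceT => t.
  exact/differentiable_continuous/derivable1_diffP.
rewrite in_itv /= => /andP[c0 c1].
have dkc : dk c <= 0.
  rewrite /dk opprD addrA -dotBl subr_le0.
  apply: le_trans (dot_le_enorm _ _) _.
  apply: (@le_trans _ _ (L * enorm (c *: d) * enorm d)).
    rewrite ler_wpM2r ?enorm_ge0//.
    by rewrite -{2}[c *: d](addrK u); exact: hL.
  by rewrite enormZ ger0_norm ?(ltW c0)// le_eqVlt; apply/orP; left; apply/eqP; ring.
rewrite /k scale1r scale0r add0r {1}/d subrK => k10.
move: k10 dkc; rewrite expr1n expr0n /=; lra.
Qed.

End Gradient.

Section Subdifferential.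
Variables (R : realType) (n : nat).
Implicit Types (u v : 'rV[R]_n) (f : 'rV[R]_n -> \bar R).

Lemma effdom_fin_num f u :
  (forall v, (-oo < f v)%E) -> effdom f u -> f u \is a fin_num.
Proof. by move=> fNoo uf; rewrite fin_numE -ltey uf andbT gt_eqF. Qed.

(** A lower semicontinuous function is sequentially lower semicontinuous. *)
Lemma lsc_lim_le f (x : nat -> 'rV[R]_n) u (a : nat -> R) (l : R) :
  lower_semicontinuous f -> x @ \oo --> u -> a @ \oo --> l ->
  (forall k, (f (x k) <= (a k)%:E)%E) -> (f u <= l%:E)%E.
Proof.
move=> lsc xu al fa; rewrite leNgt; apply/negP => lf.
have [b lb bf] : exists2 b : R, l < b & (b%:E < f u)%E.
  move: lf; case: (f u) => [r| |//] lf.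
    by exists ((l + r) / 2); rewrite ?lte_fin in lf *; lra.
  by exists (l + 1); rewrite ?ltry//; lra.
have [V uV Vb] := lsc _ _ bf.
near \oo => k.
have : (b%:E < (a k)%:E)%E.
  by apply: lt_le_trans (fa k); apply: Vb; near: k; exact: xu.
apply/negP; rewrite -leNgt lee_fin ltW//; near: k.
exact: cvgr_lt lb.
Unshelve. all: by end_near. Qed.

Lemma cvg_dot (x y : nat -> 'rV[R]_n) u v :
  x @ \oo --> u -> y @ \oo --> v -> dot (x k) (y k) @[k --> \oo] --> dot u v.
Proof.
move=> xu yv; apply: cvg_big => [|i _]; first exact: add_continuous.
have coord (z : nat -> 'rV[R]_n) (w : 'rV[R]_n) : z @ \oo --> w ->
    z k 0 i @[k --> \oo] --> w 0 i.
  by move=> zw; exact: (cvg_comp _ _ zw (@coord_continuous _ _ _ 0 i w)).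
by apply: cvgM; exact: coord.
Qed.

(** The graph of the subdifferential is sequentially closed. *)
Lemma convex_subdiff_closed f (x y : nat -> 'rV[R]_n) u v :
  eproper f -> lower_semicontinuous f -> x @ \oo --> u -> y @ \oo --> v ->
  (forall k, convex_subdiff f (x k) (y k)) -> convex_subdiff f u v.
Proof.
move=> [fNoo [w0 w0f]] lsc xu yv sub.
have key w : effdom f w -> (f u <= (fine (f w) - dot v (w - u))%:E)%E.
  move=> wf; have wfin := effdom_fin_num fNoo wf.
  apply: (lsc_lim_le (a := fun k => fine (f w) - dot (y k) (w - x k)) lsc xu).
    apply: cvgB; first exact: cvg_cst.
    by apply: cvg_dot => //; apply: cvgB => //; exact: cvg_cst.
  move=> k; have [_ /(_ w)] := sub k.
  by rewrite sube0 -{1}(fineK wfin) -leeBrDr// EFinB.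
have uf : effdom f u by apply: le_lt_trans (key _ w0f) (ltry _).
split => // w; rewrite sube0.
have [wf|/negP] := boolP (f w < +oo)%E; last first.
  by rewrite ltNge => /negP/negPn; rewrite leye_eq => /eqP ->; rewrite leey.
have wfin := effdom_fin_num fNoo wf.
have := key _ wf; rewrite EFinB fineK// leeBrDr//.
Qed.

(** At a point of differentiability the only possible subgradient is the
    gradient. *)
Lemma subgradient_eq_grad (g : 'rV[R]_n -> R) u v :
  differentiable g u -> convex_subdiff (EFin \o g) u v -> v = grad g u.
Proof.
move=> dg [_ sub]; apply/eqP; rewrite -subr_eq0; apply/eqP/enorm_eq0.
set w := v - _; apply/eqP; rewrite eq_le enorm_ge0 andbT.
rewrite leNgt; apply/negP => w0.
have w2 : 0 < enorm w / 2 by rewrite divr_gt0.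
have [d d0 dP] := differentiable_approx dg w2.
(* the subgradient inequality is tested at a short step in the direction [w] *)
pose s := d / (2 * enorm w).
have s0 : 0 < s by rewrite divr_gt0// mulr_gt0.
have sw : enorm (s *: w) = s * enorm w by rewrite enormZ gtr0_norm.
have := dP (s *: w + u); rewrite addrK sw.
have -> : s * enorm w < d.
  by rewrite /s invfM mulrA divfK ?gt_eqF// ltr_pdivrMr//; lra.
move=> /(_ isT); have := sub (s *: w + u).
rewrite sube0 addrK /= -EFinD lee_fin !dotZr => gs /(le_trans (ler_norm _)).
have vwE : dot v w = dot (grad g u) w + enorm w ^+ 2.
  by rewrite sqr_enorm addrC -dotDl subrK.
have : 0 < s * enorm w ^+ 2 by rewrite mulr_gt0// exprn_gt0.
move: gs; rewrite vwE; lra.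
Qed.

End Subdifferential.

(** * Sequences and one-dimensional inequalities *)

Section Sequences.
Variable (R : realType).

Lemma cvg_subsequence (T : topologicalType) (u : nat -> T) (l : T) (s : nat -> nat) :
  (forall j, (j <= s j)%N) -> u @ \oo --> l -> (u \o s) @ \oo --> l.
Proof.
move=> sj ul V /ul[N _ NV]; exists N => // j /= Nj; apply: NV => /=.
exact: leq_trans Nj (sj j).
Qed.

(** The tails of a convergent series of nonnegative reals. *)
Lemma summable_tail (r : nat -> R) : (forall k, 0 <= r k) ->
  (\sum_(0 <= k <oo) (r k)%:E < +oo)%E ->
  exists s : nat -> R,
    [/\ forall k, (\sum_(k <= i <oo) (r i)%:E)%E = (s k)%:E,
        forall k, 0 <= s k,
        forall k, s k = r k + s k.+1 &
        s @ \oo --> 0].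
Proof.
move=> r0 roo.
have r0E k : (0 <= (r k)%:E)%E by rewrite lee_fin.
have ge0 k : (0 <= \sum_(k <= i <oo) (r i)%:E)%E by apply: nneseries_ge0.
have fin k : (\sum_(k <= i <oo) (r i)%:E)%E \is a fin_num.
  rewrite ge0_fin_numE//; apply: le_lt_trans roo.
  rewrite [leRHS](nneseries_split 0 k)// add0n leeDr//.
  exact: sume_ge0.
exists (fun k => fine (\sum_(k <= i <oo) (r i)%:E)%E); split.
- by move=> k; rewrite fineK.
- by move=> k; exact: fine_ge0.
- move=> k; rewrite (nneseries_split k 1)// addn1 big_nat1 fineD//.
- by apply: fine_cvg; exact: nneseries_tail_cvg.
Qed.

Lemma nonincreasing_ge0_cvg (u : nat -> R) :
  (forall k, u k.+1 <= u k) -> (forall k, 0 <= u k) ->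
  exists l : R, [/\ u @ \oo --> l, 0 <= l & forall k, l <= u k].
Proof.
move=> dec u0.
have noninc : nonincreasing_seq u by apply/nonincreasing_seqP.
have lbu : has_lbound (range u) by exists 0 => _ [k _ <-].
have cu := nonincreasing_is_cvgn noninc lbu.
exists (limn u); split=> //.
  by apply: limr_ge => //; exact: nearW.
by move=> k; exact: nonincreasing_cvgn_ge.
Qed.

Lemma cvg_sqr0 (u : nat -> R) : (forall k, 0 <= u k) ->
  u k ^+ 2 @[k --> \oo] --> 0 -> u @ \oo --> 0.
Proof.
move=> u0 u2; have -> : u = (fun k => Num.sqrt (u k ^+ 2)).
  by apply/funext => k; rewrite sqrtr_sqr ger0_norm.
rewrite -sqrtr0; exact: (cvg_comp _ _ u2 (@sqrt_continuous R 0)).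
Qed.

Lemma bounded_compact_hull (n : nat) (A : set 'rV[R]_n) :
  bounded_set A -> exists2 K, compact K & A `<=` K.
Proof.
move=> [M [_ AM]]; exists [set v : 'rV[R]_n | `|v| <= M + 1]; last first.
  by move=> v Av; apply: (AM (M + 1)) => //; rewrite ltrDl.
apply: bounded_closed_compact.
  exists (M + 1); split; first by rewrite num_real.
  by move=> N MN v /= /le_trans; apply; exact: ltW.
by apply: (closed_comp (f := fun v : 'rV[R]_n => `|v|) (D := [set r | r <= M + 1]));
  [move=> v _; exact: norm_continuous | exact: closed_le].
Qed.

Lemma bounded_seq_cluster (n : nat) (x : nat -> 'rV[R]_n) :
  bounded_set (range x) ->
  exists (u : 'rV[R]_n) (s : nat -> nat),
    (forall j, (j <= s j)%N) /\ (x \o s) @ \oo --> u.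
Proof.
move=> /bounded_compact_hull[K Kc rK].
have xK : (x @ \oo) K by exists 0%N => // k _ /=; apply: rK; exists k.
have [u [_ uc]] := Kc _ _ xK.
have pick j : exists k, (j <= k)%N /\ enorm (x k - u) < j.+1%:R^-1.
  have tailj : (x @ \oo) [set v | exists2 k, (j <= k)%N & x k = v].
    by exists j => // k jk; exists k.
  have uV : nbhs u [set v | enorm (v - u) < j.+1%:R^-1].
    by apply/nbhs_enormP; exists j.+1%:R^-1; rewrite ?invr_gt0.
  by have [_ [[k jk <-] /= ku]] := uc _ _ tailj uV; exists k.
have [s sP] := choice pick.
exists u, s; split; first by move=> j; exact: (sP j).1.
apply/cvg_enormP.
apply: (squeeze_cvgr (f := fun=> 0) (h := fun j => j.+1%:R^-1 : R)).
- by near=> j; rewrite enorm_ge0 ltW//; exact: (sP j).2.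
- exact: cvg_cst.
- exact: cvg_harmonic.
Unshelve. all: by end_near. Qed.

Lemma bounded_seq_image_le (n : nat) (x : nat -> 'rV[R]_n) (g : 'rV[R]_n -> R) :
  bounded_set (range x) -> continuous g ->
  exists2 M : R, 0 < M & forall k, g (x k) <= M.
Proof.
move=> /bounded_compact_hull[K Kc rK] gc.
have : compact (g @` K) by apply: continuous_compact => //; exact: continuous_subspaceT.
move=> /compact_bounded[M [_ gM]].
exists (`|M| + 1); first by rewrite ltr_wpDl.
move=> k; apply: le_trans (ler_norm _) _; apply: (gM (`|M| + 1)).
  by rewrite (le_lt_trans (ler_norm M))// ltrDl.
by exists (x k) => //; apply: rK; exists k.
Qed.

(** The tangent inequality for the convex function [t^tau / tau] on the
    half-line, including the end point [0]; it is Young's inequality. *)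
Lemma powR_tangent (tau s t : R) : 1 < tau -> 0 <= s -> 0 <= t ->
  s `^ tau / tau + s `^ (tau - 1) * (t - s) <= t `^ tau / tau.
Proof.
move=> tau1 s0 t0.
have tau0 : 0 < tau by lra.
have t10 : 0 < tau - 1 by lra.
pose q := tau / (tau - 1).
have q0 : 0 < q by rewrite divr_gt0.
have pq : tau^-1 + q^-1 = 1 by rewrite /q; field; rewrite ?gt_eqF.
have := conjugate_powR t0 (powR_ge0 s (tau - 1)) tau0 q0 pq.
rewrite -powRrM /q mulrCA divff ?gt_eqF// mulr1.
have ss : s `^ (tau - 1) * s = s `^ tau.
  have [->|s_neq0] := eqVneq s 0; first by rewrite mulr0 powR0 ?gt_eqF.
  rewrite -[X in _ * X](powRr1 s0) -powRD ?s_neq0 ?implybT//.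
  by rewrite subrK.
have -> : s `^ tau / (tau / (tau - 1)) = s `^ tau - s `^ tau / tau.
  by field; rewrite ?gt_eqF.
rewrite mulrBr ss; lra.
Qed.

(** A concave function lies below its tangents, also at the end point [0] where
    it need not be differentiable. *)
Lemma desingularizing_tangent (nu : \bar R) (phi : R -> R) (a b : R) :
  desingularizing nu phi -> 0 < a -> (a%:E < nu)%E -> 0 <= b -> b <= a ->
  phi b <= phi a + derive1 phi a * (b - a).
Proof.
move=> [conc _ _ _ dphi] a0 anu b0.
rewrite le_eqVlt => /predU1P[->|ba]; first by rewrite subrr mulr0 addr0.
have [dera _ _] := dphi a a0 anu.
suff : derive1 phi a <= (phi b - phi a) / (b - a).
  by rewrite ler_ndivlMr ?subr_lt0// -lerBlDl.
have der : (fun t : R => t^-1 *: (phi (t + a) - phi a)) @ 0^'- --> derive1 phi a.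
  have : (fun t : R => t^-1 *: (phi (t *: 1 + a) - phi a)) @ 0^' --> derive1 phi a.
    by rewrite derive1E; exact: dera.
  under eq_fun do rewrite [_ *: 1]mulr1.
  exact: cvg_dnbhs_at_left.
rewrite -(cvg_lim _ der)//.
apply: limr_le; first by apply/cvg_ex; exists (derive1 phi a).
near=> t.
have t0 : t < 0 by near: t; exact: nbhs_left_lt.
have tba : b - a < t.
  by near: t; apply: nbhs_left_gt; rewrite subr_lt0.
pose l := t / (b - a).
have ba0 : b - a < 0 by rewrite subr_lt0.
have l0 : 0 < l by rewrite /l nmulr_rgt0 ?invr_lt0.
have l1 : l < 1 by rewrite /l ltr_ndivrMr// mul1r.
have tl : t = l * (b - a) by rewrite /l divfK// lt_eqF.
have bnu : (b%:E < nu)%E by apply: lt_trans anu; rewrite lte_fin.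
have li : (0 <= l <= 1)%R by rewrite !ltW.
have cc : l * phi b + (1 - l) * phi a <= phi (t + a).
  have := conc (Itv01 (ltW l0) (ltW l1)) b a.
  rewrite !inE => /(_ (conj b0 bnu) (conj (ltW a0) anu)).
  rewrite -[leLHS]/(- phi (l * b + (1 - l) * a)).
  rewrite -[leRHS]/(l * - phi b + (1 - l) * - phi a).
  have -> : l * b + (1 - l) * a = t + a by rewrite tl; ring.
  by rewrite !mulrN -opprD lerN2.
rewrite /GRing.scale /= mulrC ler_ndivlMr//.
have -> : (phi (t + a) - phi a) / t * (b - a) = (phi (t + a) - phi a) / l.
  by rewrite /l invf_div mulrA mulrAC.
rewrite ler_pdivlMr//; move: cc; lra.
Unshelve. all: by end_near. Qed.

Lemma desingularizing_cvg0 (nu : \bar R) (phi : R -> R) (E : nat -> R) :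
  desingularizing nu phi -> (forall k, 0 <= E k) -> E @ \oo --> 0 ->
  phi (E k) @[k --> \oo] --> 0.
Proof.
move=> [_ phi0 _ + _] E0 Ec; rewrite phi0 => phic.
apply/cvgrPdist_lt => e e0.
move/cvgrPdist_lt : phic => /(_ _ e0)[del /= del0 delP].
move/cvgrPdist_lt : Ec => /(_ _ del0); apply: filterS => k /= kdel.
have := E0 k; rewrite le_eqVlt => /predU1P[<-|Ek0].
  by rewrite phi0 subrr normr0.
by apply: delP => //=; rewrite -ball_normE /=.
Qed.

Lemma powR_inv_cvg0 (tau : R) (u : nat -> R) : 0 < tau -> (forall k, 0 <= u k) ->
  u @ \oo --> 0 -> u k `^ tau^-1 @[k --> \oo] --> 0.
Proof.
move=> tau0 u0 uc; apply/cvgrPdist_lt => e e0.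
have et0 : 0 < e `^ tau by exact: powR_gt0.
move/cvgrPdist_lt : uc => /(_ _ et0); apply: filterS => k /=.
rewrite !sub0r !normrN !ger0_norm ?powR_ge0// => uk.
have -> : e = (e `^ tau) `^ tau^-1.
  by rewrite -powRrM divff ?gt_eqF// powRr1// ltW.
by rewrite gt0_ltr_powR ?invr_gt0// nnegrE// powR_ge0.
Qed.

End Sequences.

(** The capture argument. If [u] is a cluster point, consecutive steps tend to
    zero, and as long as two consecutive iterates are close to [u] the next step
    is at most half the sum of the previous step, a telescoping term and a
    summable term, then the total length of the path from a late iterate close to
    [u] is small, so the sequence never leaves a small ball. *)
Lemma capture_cvg (R : realType) (n : nat) (x : nat -> 'rV[R]_n) (u : 'rV[R]_n)
    (rho : R) (N0 : nat) (P r s : nat -> R) (sigma : nat -> nat) :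
  (forall j, (j <= sigma j)%N) -> (x \o sigma) @ \oo --> u ->
  0 < rho -> (forall k, (N0 <= k)%N -> 0 <= P k) -> P @ \oo --> 0 ->
  (forall k, 0 <= s k) -> (forall k, s k = r k + s k.+1) -> s @ \oo --> 0 ->
  enorm (x k.+1 - x k) @[k --> \oo] --> 0 ->
  (forall k, (N0 <= k)%N -> enorm (x k - u) < rho -> enorm (x k.+1 - u) < rho ->
     2 * enorm (x k.+2 - x k.+1) <=
       P k.+1 - P k.+2 + enorm (x k.+1 - x k) + r k) ->
  x @ \oo --> u.
Proof.
move=> sig xu rho0 P0 Pc s0 sE sc dc step.
apply/cvg_enormP/cvgrPdist_lt => e e0.
pose q := Num.min e rho.
have q0 : 0 < q by rewrite lt_min e0 rho0.
have q5 : 0 < q / 5 by rewrite divr_gt0.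
move/cvg_enormP/cvgrPdist_lt/(_ _ q5) : xu => [N1 _ N1P].
move/cvgrPdist_lt/(_ _ q5) : Pc => [N2 _ N2P].
move/cvgrPdist_lt/(_ _ q5) : sc => [N3 _ N3P].
move/cvgrPdist_lt/(_ _ q5) : dc => [N4 _ N4P].
pose m := (N0 + N1 + N2 + N3 + N4)%N.
pose k0 := sigma m.
have mk0 : (m <= k0)%N by exact: sig.
have Nk0 : (N0 <= k0)%N by move: mk0; rewrite /m; lia.
have k0u : enorm (x k0 - u) < q / 5.
  have /= := N1P m; rewrite sub0r normrN ger0_norm ?enorm_ge0//.
  by apply; rewrite /m; lia.
have Pk0 : P k0.+1 < q / 5.
  have /= := N2P k0.+1; rewrite sub0r normrN ger0_norm; last by apply: P0; lia.
  by apply; move: mk0; rewrite /m; lia.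
have sk0 : s k0 < q / 5.
  have /= := N3P k0; rewrite sub0r normrN ger0_norm//.
  by apply; move: mk0; rewrite /m; lia.
have dk0 : enorm (x k0.+1 - x k0) < q / 5.
  have /= := N4P k0; rewrite sub0r normrN ger0_norm ?enorm_ge0//.
  by apply; move: mk0; rewrite /m; lia.
have qrho : q <= rho by rewrite ge_min lexx orbT.
pose d k := enorm (x k.+1 - x k).
pose S j := \sum_(i < j) d (k0.+1 + i)%N.
have S0 j : 0 <= S j by apply: sumr_ge0 => i _; exact: enorm_ge0.
have inv j : [/\ enorm (x (k0 + j)%N - u) < q,
    enorm (x (k0 + j).+1 - u) <= enorm (x k0 - u) + d k0 + S j &
    S j + d (k0 + j)%N <= d k0 + P k0.+1 - P (k0 + j).+1 + (s k0 - s (k0 + j)%N)].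
  elim: j => [|j [xj xj1 Sj]].
    rewrite addn0 /S big_ord0 !subrr !addr0 add0r addrK; split=> //; first lra.
    exact: enorm_triangle.
  have dj0 : 0 <= d (k0 + j)%N by exact: enorm_ge0.
  have Pj0 : 0 <= P (k0 + j).+1 by apply: P0; lia.
  have sj0 := s0 (k0 + j)%N.
  have xj1q : enorm (x (k0 + j).+1 - u) < q.
    by apply: le_lt_trans xj1 _; rewrite -/(d k0) in dk0; lra.
  have := step (k0 + j)%N; rewrite -!/(d _).
  move=> /(_ (leq_trans Nk0 (leq_addr _ _)) (lt_le_trans xj qrho)
             (lt_le_trans xj1q qrho)) dstep.
  have SE : S j.+1 = S j + d (k0 + j).+1 by rewrite /S big_ord_recr /= addSn.
  rewrite addnS; split=> //.
    rewrite SE; apply: (@le_trans _ _ (enorm (x (k0 + j).+1 - u) + d (k0 + j).+1)).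
      exact: enorm_triangle.
    lra.
  rewrite SE; have := sE (k0 + j)%N; lra.
exists k0 => // k /= k0k.
rewrite sub0r normrN ger0_norm ?enorm_ge0//.
have [+ _ _] := inv (k - k0)%N; rewrite subnKC// => /lt_le_trans; apply.
by rewrite ge_min lexx.
Qed.

(** * Subgradients of the fractional objective and of its potential *)

Section Blocks.
Variables (R : realType) (n : nat).
Implicit Types (u v : 'rV[R]_n) (z : 'rV[R]_(n + 1)).

(** The point [(u, t)] of the product space. *)
Definition pt u (t : R) : 'rV[R]_(n + 1) := row_mx u (const_mx t).

Lemma lsubmx_pt u t : lsubmx (pt u t) = u.
Proof. exact: row_mxKl. Qed.

Lemma rsubmx_pt u t : rsubmx (pt u t) 0 0 = t.
Proof. by rewrite row_mxKr mxE. Qed.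

Lemma dot_pt u v s t : dot (pt u s) (pt v t) = dot u v + s * t.
Proof.
rewrite /dot big_split_ord /= big_ord1; congr (_ + _).
  by apply: eq_bigr => i _; rewrite /pt !row_mxEl.
by rewrite /pt !row_mxEr !mxE.
Qed.

Lemma ptE z : z = pt (lsubmx z) (rsubmx z 0 0).
Proof.
rewrite -{1}(hsubmxK z); congr (row_mx _ _).
by apply/matrixP => i j; rewrite [RHS]mxE !ord1.
Qed.

Lemma ptB u v s t : pt u s - pt v t = pt (u - v) (s - t).
Proof.
rewrite /pt opp_row_mx add_row_mx; congr (row_mx _ _).
by apply/matrixP => i j; rewrite !mxE.
Qed.

Lemma enorm_pt_le u t : enorm (pt u t) <= enorm u + `|t|.
Proof.
rewrite -(@ler_pXn2r _ 2) ?nnegrE ?addr_ge0 ?enorm_ge0//.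
rewrite sqr_enorm dot_pt sqrrD sqr_enorm real_normK ?num_real// -expr2.
by rewrite lerD2r lerDl mulrn_wge0// mulr_ge0 ?enorm_ge0.
Qed.

Lemma enorm_le_pt u t : enorm u <= enorm (pt u t).
Proof.
rewrite -(@ler_pXn2r _ 2) ?nnegrE ?enorm_ge0// !sqr_enorm dot_pt lerDl.
by rewrite -expr2 sqr_ge0.
Qed.

End Blocks.

Section FrechetSubdifferential.
Variables (R : realType) (n : nat).
Implicit Types (psi : 'rV[R]_n -> \bar R) (u d : 'rV[R]_n).

(** A vector that supports the function up to a little-o of the distance is a
    Frechet subgradient. *)
Lemma frechet_subdiff_approx psi u d (p : R) :
  psi u = p%:E ->
  (forall e : R, 0 < e -> exists2 del : R, 0 < del &
     forall v, enorm (v - u) < del ->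
       ((p + dot d (v - u) - e * enorm (v - u))%:E <= psi v)%E) ->
  frechet_subdiff psi u d.
Proof.
move=> psiu approx; split; first by rewrite /effdom /= psiu ltry.
rewrite limf_einfE; apply/lee_subgt0Pr => e e0; rewrite sub0e.
have [del del0 delP] := approx e e0.
pose V := [set v | v != u /\ enorm (v - u) < del].
have uV : u^' V.
  by apply/nbhs_enormP; exists del.
pose G v := ((psi v - psi u - (dot d (v - u)%R)%:E) * ((enorm (v - u)%R)^-1)%:E)%E.
suff GV : (- e%:E <= ereal_inf (G @` V))%E.
  by apply: le_trans GV _; apply: ereal_sup_ubound; exists V.
rewrite /G.
apply: le_ereal_inf_tmp => _ [v [vneu vu] <-].
have := delP v vu; rewrite psiu.
have vu0 : 0 < enorm (v - u).
  rewrite lt_def enorm_ge0 andbT; apply: contra_neq vneu => /enorm_eq0/eqP.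
  by rewrite subr_eq0 => /eqP.
case: (psi v) => [r| |//]; last first.
  by move=> _; rewrite -addeA addye// gt0_mulye ?lte_fin ?invr_gt0// leey.
rewrite lee_fin => rP.
rewrite -!EFinB -EFinM lee_fin ler_pdivlMr//; lra.
Qed.

Lemma frechet_sub_limiting psi u d :
  frechet_subdiff psi u d -> limiting_subdiff psi u d.
Proof.
move=> ud; split; first exact: ud.1.
by exists (fun=> u), (fun=> d); split=> //; exact: cvg_cst.
Qed.

Lemma dist0_le psi u d :
  frechet_subdiff psi u d -> (dist0 (limiting_subdiff psi u) <= (enorm d)%:E)%E.
Proof.
by move=> ud; apply: ereal_inf_lbound; exists d => //; exact: frechet_sub_limiting.
Qed.

End FrechetSubdifferential.

Section Potential.
Variables (R : realType) (n : nat) (f : 'rV[R]_n -> \bar R).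
Variables (h g : 'rV[R]_n -> R).
Implicit Types (u v xi : 'rV[R]_n).

Lemma objF_ratio v : effdom f v -> g v != 0 ->
  objF f h g v = (Defs.ratio f h g v)%:E.
Proof. by move=> vf vg; rewrite /objF; case: asboolP => // -[]. Qed.

(** The quotient-rule subgradient of [(f + h) / g] at [u] obtained from a
    subgradient [xi] of [f]. *)
Definition ratio_subgrad u xi : 'rV[R]_n :=
  (g u)^-1 *: (xi + grad h u - Defs.ratio f h g u *: grad g u).

Lemma ratio_subgrad_approx u xi (e : R) :
  (forall v, (-oo < f v)%E) ->
  effdom f u -> 0 < g u -> differentiable h u -> differentiable g u ->
  {for u, continuous g} -> convex_subdiff f u xi -> 0 < e ->
  exists2 del : R, 0 < del & forall v, effdom f v -> enorm (v - u) < del ->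
    Defs.ratio f h g u + dot (ratio_subgrad u xi) (v - u) - e * enorm (v - u)
      <= Defs.ratio f h g v /\ 0 < g v.
Proof.
move=> fNoo uf gu dh dg cg [_ fsub] e0.
set F := Defs.ratio f h g u; set w := ratio_subgrad u xi.
have gu2 : 0 < g u / 2 by rewrite divr_gt0.
(* total error: [e1] from [h], [e1 * |F|] from [g], [e1] from [(g v - g u) w] *)
pose e1 := e * (g u / 2) / (2 + `|F|).
have F2 : 0 < 2 + `|F| by rewrite ltr_pwDl.
have e10 : 0 < e1 by rewrite divr_gt0// mulr_gt0.
have [d1 d10 hP] := differentiable_approx dh e10.
have [d2 d20 gP] := differentiable_approx dg e10.
have w1 : 0 < 1 + enorm w by rewrite ltr_pwDl// enorm_ge0.
pose e2 := Num.min (g u / 2) (e1 / (1 + enorm w)).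
have e20 : 0 < e2 by rewrite lt_min gu2 divr_gt0.
have [d3 d30 gc] : exists2 d : R, 0 < d & forall v, enorm (v - u) < d ->
    `|g u - g v| < e2.
  by have /cvgrPdist_lt/(_ _ e20)/nbhs_enormP := cg.
exists (Num.min d1 (Num.min d2 d3)); first by rewrite !lt_min d10 d20.
move=> v vf; rewrite !lt_min => /and3P[vd1 vd2 vd3].
have {}hP := hP v vd1; have {}gP := gP v vd2; have {}gc := gc v vd3.
have gv2 : g u / 2 < g v.
  have : `|g u - g v| < g u / 2 by apply: lt_le_trans gc _; rewrite ge_min lexx.
  by move/(le_lt_trans (ler_norm _)); lra.
have gv : 0 < g v by exact: lt_trans gv2.
split=> //.
have fv : fine (f u) + dot xi (v - u) <= fine (f v).
  have := fsub v; rewrite sube0 -{1}(fineK (effdom_fin_num fNoo uf)).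
  rewrite -{1}(fineK (effdom_fin_num fNoo vf)).
  by rewrite -EFinD lee_fin.
set del := v - u in fv hP gP *; set E := enorm del in hP gP *.
have E0 : 0 <= E by exact: enorm_ge0.
have Nu : fine (f u) + h u = F * g u by rewrite /F /Defs.ratio divfK ?gt_eqF.
have wE : dot xi del + dot (grad h u) del - F * dot (grad g u) del
        = g u * dot w del.
  by rewrite /w /ratio_subgrad dotZl mulrA divff ?gt_eqF// mul1r dotBl dotDl dotZl.
have wdel : `|(g u - g v) * dot w del| <= e1 * E.
  rewrite normrM; apply: (@le_trans _ _ (e1 / (1 + enorm w) * (enorm w * E))).
    apply: ler_pM => //; last exact: abs_dot_le.
    by apply: le_trans (ltW gc) _; rewrite ge_min lexx orbT.
  rewrite mulrA ler_wpM2r// mulrAC ler_pdivrMr// ler_wpM2l ?(ltW e10)//.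
  by rewrite lerDr.
have FgP : `|F * (g v - g u - dot (grad g u) del)| <= `|F| * (e1 * E).
  by rewrite normrM ler_wpM2l.
have eE : (2 + `|F|) * e1 = e * (g u / 2) by rewrite /e1 mulrC divfK ?gt_eqF.
rewrite /Defs.ratio ler_pdivlMr//.
have : (2 + `|F|) * (e1 * E) <= e * E * g v.
  rewrite mulrA eE mulrAC ler_wpM2l ?mulr_ge0 ?(ltW e0)//; exact: ltW.
move: hP wdel FgP; rewrite !ler_norml => /andP[h1 _] /andP[w2 _] /andP[_ F2'].
lra.
Qed.

Lemma frechet_subdiff_Phi (tau t : R) u xi :
  (forall v, (-oo < f v)%E) ->
  effdom f u -> 0 < g u -> differentiable h u -> differentiable g u ->
  {for u, continuous g} -> convex_subdiff f u xi -> 1 < tau -> 0 <= t ->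
  frechet_subdiff (Phi (objF f h g) tau) (pt u t)
    (pt (ratio_subgrad u xi) (t `^ (tau - 1))).
Proof.
move=> fNoo uf gu dh dg cg fsub tau1 t0.
apply: (@frechet_subdiff_approx _ _ _ _ _ (Defs.ratio f h g u + t `^ tau / tau)).
  by rewrite /Phi lsubmx_pt rsubmx_pt t0 objF_ratio ?gt_eqF.
move=> e e0.
have [del del0 delP] := ratio_subgrad_approx fNoo uf gu dh dg cg fsub e0.
exists del => // z; rewrite (ptE z) ptB dot_pt /Phi lsubmx_pt rsubmx_pt.
set v := lsubmx z; set s := rsubmx z 0 0 => vs.
have [s0|] := leP 0 s; last by rewrite leey.
have vu : enorm (v - u) < del by apply: le_lt_trans vs; exact: enorm_le_pt.
have [[vf gv]|] := pselect (effdom f v /\ g v != 0); last first.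
  by move=> nv; rewrite /objF; case: asboolP => // _; rewrite addye ?leey.
rewrite objF_ratio// -EFinD lee_fin.
have [Fv _] := delP v vf vu.
have tP := powR_tangent tau1 t0 s0.
have := enorm_le_pt (v - u) (s - t).
move=> /(ler_wpM2l (ltW e0)); lra.
Qed.

End Potential.

(** * One step of the algorithm *)

Section Step.
Variables (R : realType) (n : nat) (f : 'rV[R]_n -> \bar R).
Variables (h g : 'rV[R]_n -> R) (Lh : R).
Hypothesis f_gtNy : forall v, (-oo < f v)%E.
Hypothesis h_C1 : C1_on setT h.
Hypothesis Lh_gt0 : 0 < Lh.
Hypothesis h_lip :
  forall v w, enorm (grad h v - grad h w) <= Lh * enorm (v - w).
Implicit Types (u v w xi y : 'rV[R]_n).

(** Sufficient decrease of the objective, up to the inexactness [e]. *)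
Lemma descent_step v w xi y D (H : 'M[R]_n) (del gl e : R) :
  effdom f v -> effdom f w -> 0 < g v -> 0 < g w -> 0 <= Defs.ratio f h g v ->
  eps_subdiff del f w xi -> convex_subdiff (EFin \o g) v y ->
  D = xi + grad h v - Defs.ratio f h g v *: y + (w - v) *m H ->
  enorm D ^+ 2 + `|dot D (w - v)| + del <= e * g w ->
  loewner_le gl%:M H ->
  Defs.ratio f h g w + (gl - Lh / 2) / g w * enorm (w - v) ^+ 2
    <= Defs.ratio f h g v + e.
Proof.
move=> vf wf gv gw c0 [_ fsub] [_ gsub] DE err [_ glH].
set c := Defs.ratio f h g v in c0 DE *; set d := w - v in DE err *.
have fP : fine (f w) - dot xi d - del <= fine (f v).
  have := fsub v; rewrite -(fineK (effdom_fin_num f_gtNy vf)).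
  rewrite -(fineK (effdom_fin_num f_gtNy wf)).
  by rewrite -!EFinD lee_fin -[v - w]opprB dotNr.
have gP : g v + dot y d <= g w by have := gsub w; rewrite sube0 /= -EFinD lee_fin.
have hP := descent_lemma v w h_C1 (ltW Lh_gt0) h_lip; rewrite -/d in hP.
have HP : gl * enorm d ^+ 2 <= dot (d *m H) d.
  by have := glH d; rewrite mulmxBr mul_mx_scalar dotBl dotZl subr_ge0 sqr_enorm.
have DP : dot D d = dot xi d + dot (grad h v) d - c * dot y d + dot (d *m H) d.
  by rewrite DE dotDl dotBl dotDl dotZl.
have D0 : 0 <= enorm D ^+ 2 by rewrite exprn_ge0 ?enorm_ge0.
have Dd : dot D d <= `|dot D d| by exact: ler_norm.
have Nv : fine (f v) + h v = c * g v by rewrite /c /Defs.ratio divfK ?gt_eqF.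
have cgP := ler_wpM2l c0 gP.
have key : fine (f w) + h w + (gl - Lh / 2) * enorm d ^+ 2 <= (c + e) * g w by lra.
have -> : Defs.ratio f h g w + (gl - Lh / 2) / g w * enorm d ^+ 2
        = (fine (f w) + h w + (gl - Lh / 2) * enorm d ^+ 2) / g w.
  by rewrite /Defs.ratio; field; rewrite gt_eqF.
by rewrite ler_pdivrMr.
Qed.

(** Local bounds near a point [u] of the domain of the objective, for pairs of
    points at which the gradient of [g] is a subgradient. *)
Lemma ratio_lipschitz_near u (Cm : R) :
  effdom f u -> 0 < g u -> continuous g ->
  locally_lipschitz_on_dom f -> locally_lipschitz_on (Omega g) (grad g) ->
  exists rho m Lc Lg Gm : R,
    [/\ [/\ 0 < rho, 0 < m, 0 <= Lc, 0 <= Lg & 0 <= Gm] &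
      forall v w, enorm (v - u) < rho -> enorm (w - u) < rho ->
        effdom f v -> effdom f w -> Omega g v -> Omega g w ->
        convex_subdiff (EFin \o g) v (grad g v) ->
        convex_subdiff (EFin \o g) w (grad g w) ->
        `|Defs.ratio f h g v| <= Cm ->
        [/\ m <= g w,
          `|Defs.ratio f h g w - Defs.ratio f h g v| <= Lc * enorm (w - v),
          enorm (grad g w - grad g v) <= Lg * enorm (w - v) &
          enorm (grad g w) <= Gm]].
Proof.
move=> uf gu gc f_ll gg_ll.
have [Of [Lf [/nbhs_enormP[r1 r10 r1P] Lf0 fP]]] := f_ll u uf.
have uO : Omega g u by rewrite /Omega /= gt_eqF.
have [Og [Lg [/nbhs_enormP[r2 r20 r2P] Lg0 gP]]] := gg_ll u uO.
have gu2 : 0 < g u / 2 by rewrite divr_gt0.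
have [r3 r30 r3P] : exists2 r : R, 0 < r & forall v, enorm (v - u) < r ->
    `|g u - g v| < g u / 2.
  by have /cvgrPdist_lt/(_ _ gu2)/nbhs_enormP := gc u.
pose rho := Num.min r1 (Num.min r2 r3).
have rho0 : 0 < rho by rewrite !lt_min r10 r20.
pose Gm := enorm (grad g u) + Lg * rho.
pose Hm := enorm (grad h u) + Lh * rho.
have Gm0 : 0 <= Gm by rewrite addr_ge0 ?enorm_ge0// mulr_ge0 ?ltW.
have Hm0 : 0 <= Hm by rewrite addr_ge0 ?enorm_ge0// mulr_ge0 ?ltW.
pose Lc := (Lf + (Hm + Lh * rho) + `|Cm| * Gm) / (g u / 2).
have Lhr0 : 0 <= Lh * rho by rewrite mulr_ge0 ?ltW.
have Lc0 : 0 <= Lc.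
  have CG0 : 0 <= `|Cm| * Gm by exact: mulr_ge0.
  by apply: divr_ge0; [lra | exact: ltW].
exists rho, (g u / 2), Lc, Lg, Gm; split; first by split=> //; exact: ltW.
move=> v w; rewrite {1 2}/rho !lt_min => /and3P[v1 v2 v3] /and3P[w1 w2 w3].
move=> vf wf vO wO gsv gsw cv.
have vrho : enorm (v - u) < rho by rewrite !lt_min v1 v2.
have wrho : enorm (w - u) < rho by rewrite !lt_min w1 w2.
have grad_bound z : enorm (z - u) < r2 -> enorm (z - u) < rho -> Omega g z ->
    enorm (grad g z) <= Gm.
  move=> z2 zrho zO; rewrite -[grad g z](subrK (grad g u)).
  apply: le_trans (enormD _ _) _; rewrite addrC lerD2l.
  apply: le_trans (gP _ _ (conj (r2P _ z2) zO) (conj (r2P u _) uO)) _.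
    by rewrite subrr enorm0.
  by rewrite ler_wpM2l ?ltW.
have gwv := grad_bound w w2 wrho wO; have gvv := grad_bound v v2 vrho vO.
have gw : g u / 2 <= g w.
  by have /(le_lt_trans (ler_norm _)) := r3P w w3; lra.
have gv : g u / 2 <= g v.
  by have /(le_lt_trans (ler_norm _)) := r3P v v3; lra.
split=> //; last exact: gP (conj (r2P _ w2) wO) (conj (r2P _ v2) vO).
set d := enorm (w - v).
have d0 : 0 <= d by exact: enorm_ge0.
have d2 : d <= 2 * rho.
  have -> : d = enorm ((w - u) - (v - u)) by rewrite /d opprB addrA subrK.
  by apply: le_trans (enormBD _ _) _; lra.
have f_bound : `|fine (f w) - fine (f v)| <= Lf * d.
  by apply: fP; split=> //; exact: r1P.
have g_bound : `|g w - g v| <= Gm * d.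
  have g1 : dot (grad g v) (w - v) <= g w - g v.
    by have [_ /(_ w)] := gsv; rewrite sube0 /= -EFinD lee_fin lerBrDl.
  have g2 : dot (grad g w) (v - w) <= g v - g w.
    by have [_ /(_ v)] := gsw; rewrite sube0 /= -EFinD lee_fin lerBrDl.
  have b1 : - (Gm * d) <= dot (grad g v) (w - v).
    rewrite lerNl -dotNr opprB; apply: le_trans (dot_le_enorm _ _) _.
    by rewrite enormB ler_wpM2r.
  have b2 : - (Gm * d) <= dot (grad g w) (v - w).
    rewrite lerNl -dotNr opprB; apply: le_trans (dot_le_enorm _ _) _.
    by rewrite ler_wpM2r.
  by rewrite ler_norml; lra.
have grad_h_bound z : enorm (z - u) < rho -> enorm (grad h z) <= Hm.
  move=> zrho; rewrite -[grad h z](subrK (grad h u)).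
  apply: le_trans (enormD _ _) _; rewrite addrC lerD2l.
  by apply: le_trans (h_lip _ _) _; rewrite ler_wpM2l ?ltW.
have h_half a b : enorm (a - u) < rho -> enorm (b - a) = d ->
    h b - h a <= (Hm + Lh * rho) * d.
  move=> arho bad; have := descent_lemma a b h_C1 (ltW Lh_gt0) h_lip.
  have := dot_le_enorm (grad h a) (b - a); rewrite bad.
  have := ler_wpM2r d0 (grad_h_bound a arho).
  have : Lh / 2 * d ^+ 2 <= Lh * rho * d.
    rewrite expr2 mulrA ler_wpM2r// -mulrA ler_wpM2l ?(ltW Lh_gt0)//.
    by rewrite mulrC ler_pdivrMr// mulrC.
  lra.
have h_bound : `|h w - h v| <= (Hm + Lh * rho) * d.
  rewrite ler_norml lerNl opprB h_half//; last by rewrite enormB.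
  by rewrite h_half.
have gw0 : 0 < g w by exact: lt_le_trans gw.
have gv0 : 0 < g v by exact: lt_le_trans gv.
set c := Defs.ratio f h g v in cv *.
have -> : Defs.ratio f h g w - c
  = ((fine (f w) - fine (f v)) + (h w - h v) - c * (g w - g v)) / g w.
  by rewrite /c /Defs.ratio; field; rewrite !gt_eqF.
rewrite normrM normfV (gtr0_norm gw0) /Lc [leRHS]mulrAC.
apply: ler_pM => //; first by rewrite invr_ge0 ltW.
  apply: le_trans (ler_normB _ _) _.
  rewrite [leRHS]mulrDl; apply: lerD.
    by apply: le_trans (ler_normD _ _) _; rewrite [leRHS]mulrDl lerD.
  rewrite normrM -mulrA; apply: ler_pM => //.
  exact: le_trans cv (ler_norm _).
by rewrite lef_pV2.
Qed.

End Step.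

(** The one-step consequence of the Kurdyka-Lojasiewicz inequality: [E1] and [E2]
    are consecutive values of the gap, [d0] and [d1] consecutive step lengths
    and [B] bounds the distance of [0] to the subdifferential. *)
Lemma kl_step (R : realType) (nu : \bar R) (phi : R -> R)
    (a C E1 E2 d0 d1 r B : R) :
  desingularizing nu phi -> 0 < a -> 0 < C -> 0 <= E2 -> E2 <= E1 ->
  (E1%:E < nu)%E -> 0 <= d0 -> 0 <= d1 -> 0 <= r ->
  a * d1 ^+ 2 <= E1 - E2 -> B <= C * (d0 + r) ->
  (0 < E1 -> 1 <= derive1 phi E1 * B) ->
  2 * d1 <= C / a * phi E1 - C / a * phi E2 + d0 + r.
Proof.
move=> des a0 C0 E20 E21 E1nu d00 d10 r0 dec BP kl.
have [E1_gt0|E1_le0] := ltP 0 E1; last first.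
  (* the gap has vanished, hence so does the step *)
  have E1E : E1 = 0 by apply: le_anti; rewrite E1_le0 (le_trans E20).
  have E2E : E2 = 0 by apply: le_anti; rewrite E20 -E1E E21.
  have d1E : d1 = 0.
    apply/eqP; rewrite -sqrf_eq0 eq_le sqr_ge0 andbT.
    by rewrite -(pmulr_rle0 _ a0); move: dec; rewrite E1E E2E subrr.
  by rewrite E1E E2E d1E mulr0 subrr add0r addr_ge0.
have tan := desingularizing_tangent des E1_gt0 E1nu E20 E21.
have [_ _ _ _ dphi] := des.
have [_ _ dphi0] := dphi _ E1_gt0 E1nu.
have {}kl := kl E1_gt0.
set p := derive1 phi E1 in tan dphi0 kl *.
set q := d0 + r.
have q0 : 0 <= q by rewrite addr_ge0.
pose A := C / a * (phi E1 - phi E2).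
have pq : 1 <= p * (C * q) by apply: le_trans kl _; rewrite ler_wpM2l// ltW.
have sq : d1 ^+ 2 <= A * q.
  have h1 : p * (a * d1 ^+ 2) <= phi E1 - phi E2.
    by have := ler_wpM2l (ltW dphi0) dec; lra.
  have Cq0 : 0 <= C * q by rewrite mulr_ge0 ?(ltW C0).
  have := ler_wpM2l Cq0 h1.
  have : a * d1 ^+ 2 <= (p * (C * q)) * (a * d1 ^+ 2).
    by rewrite ler_peMl// mulr_ge0 ?sqr_ge0// ltW.
  move=> h2 h3; rewrite -(ler_pM2l a0).
  have -> : a * (A * q) = C * q * (phi E1 - phi E2).
    by rewrite /A; field; rewrite gt_eqF.
  lra.
have A0 : 0 <= A.
  rewrite mulr_ge0 ?divr_ge0 ?(ltW C0) ?(ltW a0)//.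
  have := ler_wpM2l (ltW dphi0) dec.
  have : 0 <= p * (a * d1 ^+ 2).
    by apply: mulr_ge0; [exact: ltW | rewrite mulr_ge0 ?sqr_ge0 ?ltW].
  lra.
(* arithmetic-geometric mean inequality *)
have : 2 * d1 <= A + q.
  rewrite -(@ler_pXn2r _ 2) ?nnegrE ?mulr_ge0 ?addr_ge0//.
  have := sqr_ge0 (A - q); move: sq; nra.
rewrite /A /q; lra.
Qed.

(** * Convergence of the whole sequence *)

Section Run.
Variables (R : realType) (n : nat) (f : 'rV[R]_n -> \bar R).
Variables (h g : 'rV[R]_n -> R) (Lh : R).
Hypothesis f_proper : eproper f.
Hypothesis f_closed : lower_semicontinuous f.
Hypothesis h_C1 : C1_on setT h.
Hypothesis Lh_gt0 : 0 < Lh.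
Hypothesis h_lip :
  forall v w, enorm (grad h v - grad h w) <= Lh * enorm (v - w).
Hypothesis g_cont : continuous g.
Hypothesis g_ge0 : forall v, effdom f v -> 0 <= g v.
Hypothesis fh_ge0 : forall v, effdom f v -> (0 <= f v + (h v)%:E)%E.
Hypothesis fh_gt0 : forall v, g v = 0 -> (0 < f v + (h v)%:E)%E.
Hypothesis F_level_bounded : level_bounded (objF f h g).
Hypothesis f_loclip : locally_lipschitz_on_dom f.
Hypothesis g_C1 : C1_on (Omega g) g.
Hypothesis grad_g_loclip : locally_lipschitz_on (Omega g) (grad g).
Variables (eps : nat -> R) (H : nat -> 'M[R]_n).
Variables (x y Delta : nat -> 'rV[R]_n) (delta : nat -> R) (xi : nat -> 'rV[R]_n).
Hypothesis eps_ge0 : forall k, 0 <= eps k.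
Hypothesis H_posdef : forall k, sym_posdef (H k).
Hypothesis x_dom : forall k, Omega g (x k) /\ effdom f (x k).
Hypothesis y_sub : forall k, convex_subdiff (EFin \o g) (x k) (y k).
Hypothesis delta_ge0 : forall k, 0 <= delta k.
Hypothesis xi_sub : forall k, eps_subdiff (delta k) f (x k.+1) (xi k).
Hypothesis DeltaE : forall k,
  Delta k = xi k + grad h (x k) - Defs.ratio f h g (x k) *: y k
            + (x k.+1 - x k) *m H k.
Hypothesis Delta_err : forall k,
  enorm (Delta k) ^+ 2 + `|dot (Delta k) (x k.+1 - x k)| + delta k
    <= eps k * g (x k.+1).
Variable K0 : nat.
Hypothesis delta_eq0 : forall k, (K0 <= k)%N -> delta k = 0.
Variables (gl gu : R).
Hypothesis gu_gt0 : 0 < gu.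
Hypothesis Lh_gl : Lh / 2 < gl.
Hypothesis H_bounds :
  forall k, loewner_le gl%:M (H k) /\ loewner_le (H k) gu%:M.
Variable s : nat -> R.
Hypothesis s_ge0 : forall k, 0 <= s k.
Hypothesis sE : forall k, s k = eps k + s k.+1.
Hypothesis s_cvg0 : s @ \oo --> 0.

(** The objective value and the step length at iteration [k]. *)
Let c k := Defs.ratio f h g (x k).
Let d k := enorm (x k.+1 - x k).

Let f_gtNy : forall v, (-oo < f v)%E := f_proper.1.

Lemma g_run_gt0 k : 0 < g (x k).
Proof. by have [xO xf] := x_dom k; rewrite lt_def xO g_ge0. Qed.

Lemma ratio_run_ge0 k : 0 <= c k.
Proof.
have [_ xf] := x_dom k; apply: divr_ge0; last exact/ltW/g_run_gt0.
have := fh_ge0 xf; rewrite -(fineK (effdom_fin_num f_gtNy xf)) -EFinD.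
by rewrite lee_fin.
Qed.

Lemma ratio_run_descent k : c k.+1 + (gl - Lh / 2) / g (x k.+1) * d k ^+ 2
  <= c k + eps k.
Proof.
have [_ xf] := x_dom k; have [_ xf1] := x_dom k.+1.
exact: (descent_step f_gtNy h_C1 Lh_gt0 h_lip xf xf1 (g_run_gt0 k)
  (g_run_gt0 k.+1) (ratio_run_ge0 k) (xi_sub k) (y_sub k) (DeltaE k)
  (Delta_err k) (H_bounds k).1).
Qed.

(** Adding the tail of the tolerances turns the objective values into a
    nonincreasing sequence. *)
Lemma merit_run_nonincreasing k : c k.+1 + s k.+1 <= c k + s k.
Proof.
have := ratio_run_descent k; rewrite (sE k).
have : 0 <= (gl - Lh / 2) / g (x k.+1) * d k ^+ 2.
  by rewrite mulr_ge0 ?sqr_ge0// divr_ge0 ?subr_ge0 ?(ltW Lh_gl)// ltW// g_run_gt0.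
lra.
Qed.

Lemma ratio_run_le k : c k <= c 0%N + s 0%N.
Proof.
suff : c k + s k <= c 0%N + s 0%N by have := s_ge0 k; lra.
by elim: k => // k; apply: le_trans; exact: merit_run_nonincreasing.
Qed.

Lemma run_bounded : bounded_set (range x).
Proof.
have := F_level_bounded (c 0%N + s 0%N); rewrite /bounded_set.
apply: filterS => M MP v [k _ <-]; apply: MP => /=.
have [xO xf] := x_dom k; rewrite objF_ratio// lee_fin.
exact: ratio_run_le.
Qed.

(** The algorithm has no choice for the subgradient of [g]. *)
Lemma grad_g_run k : y k = grad g (x k).
Proof.
have [xO _] := x_dom k.
exact: subgradient_eq_grad (g_C1 xO).1 (y_sub k).
Qed.

(** Limit of the merit values and a uniform decrease estimate. *)
Lemma merit_run_limit : exists (cs M a : R),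
  [/\ [/\ 0 < M, 0 < a & forall k, g (x k) <= M],
      c @ \oo --> cs,
      forall k, 0 <= c k + s k - cs,
      (fun k => c k + s k - cs) @ \oo --> 0 &
      forall k, a * d k ^+ 2 <= (c k + s k - cs) - (c k.+1 + s k.+1 - cs)].
Proof.
have [M M0 gM] := bounded_seq_image_le run_bounded g_cont.
have [cs [mc _ csl]] := nonincreasing_ge0_cvg merit_run_nonincreasing
  (fun k => addr_ge0 (ratio_run_ge0 k) (s_ge0 k)).
have gl0 : 0 < gl - Lh / 2 by rewrite subr_gt0.
exists cs, M, ((gl - Lh / 2) / M); split.
- by split=> //; exact: divr_gt0.
- have -> : c = (fun k => c k + s k - s k) by apply/funext => k; rewrite addrK.
  by rewrite -[cs]subr0; exact: cvgB.
- by move=> k; rewrite subr_ge0.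
- by rewrite -(subrr cs); apply: cvgB => //; exact: cvg_cst.
move=> k.
have := ratio_run_descent k; rewrite (sE k).
have : (gl - Lh / 2) / M * d k ^+ 2 <= (gl - Lh / 2) / g (x k.+1) * d k ^+ 2.
  rewrite ler_wpM2r ?sqr_ge0// ler_wpM2l ?(ltW gl0)//.
  by rewrite lef_pV2 ?posrE ?g_run_gt0.
lra.
Qed.

(** The data supplied by [merit_run_limit]. *)
Section Limit.
Variables (cs M a : R).
Hypothesis M_gt0 : 0 < M.
Hypothesis a_gt0 : 0 < a.
Hypothesis gM : forall k, g (x k) <= M.
Hypothesis c_cvg : c @ \oo --> cs.
Hypothesis gap_ge0 : forall k, 0 <= c k + s k - cs.
Hypothesis gap_cvg0 : (fun k => c k + s k - cs) @ \oo --> 0.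
Hypothesis gap_decrease :
  forall k, a * d k ^+ 2 <= (c k + s k - cs) - (c k.+1 + s k.+1 - cs).

Let E k := c k + s k - cs.

Lemma step_run_cvg0 : d @ \oo --> 0.
Proof.
apply: cvg_sqr0; first by move=> k; exact: enorm_ge0.
apply: (squeeze_cvgr (f := fun=> 0) (h := fun k => a^-1 * (E k - E k.+1))).
- near=> k; rewrite sqr_ge0 /= mulrC ler_pdivlMr// mulrC; exact: gap_decrease.
- exact: cvg_cst.
rewrite -(mulr0 a^-1); apply: cvgM; first exact: cvg_cst.
rewrite -(subrr (0 : R)).
exact: (cvgB gap_cvg0 (cvg_subsequence leqnSn gap_cvg0)).
Unshelve. all: by end_near. Qed.

Lemma Delta_run_le k : enorm (Delta k) <= Num.sqrt M * Num.sqrt (eps k).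
Proof.
rewrite -sqrtrM ?(ltW M_gt0)// -[leLHS]ger0_norm ?enorm_ge0// -sqrtr_sqr.
rewrite ler_wsqrtr//.
have := Delta_err k; have := delta_ge0 k.
have := normr_ge0 (dot (Delta k) (x k.+1 - x k)).
have := ler_wpM2l (eps_ge0 k) (gM k.+1); lra.
Qed.

Lemma sqrt_eps_cvg0 : Num.sqrt (eps k) @[k --> \oo] --> 0.
Proof.
apply: cvg_sqr0; first by move=> k; exact: sqrtr_ge0.
have -> : (fun k => Num.sqrt (eps k) ^+ 2) = (fun k => s k - s k.+1).
  by apply/funext => k; rewrite sqr_sqrtr// (sE k) addrK.
rewrite -(subrr (0 : R)).
exact: (cvgB s_cvg0 (cvg_subsequence leqnSn s_cvg0)).
Qed.

Lemma Delta_run_cvg0 : Delta @ \oo --> (0 : 'rV[R]_n).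
Proof.
apply/cvg_enormP.
apply: (squeeze_cvgr (f := fun=> 0)
  (h := fun k => Num.sqrt M * Num.sqrt (eps k))).
- by near=> k; rewrite subr0 enorm_ge0 Delta_run_le.
- exact: cvg_cst.
- by rewrite -(mulr0 (Num.sqrt M)); apply: cvgM;
    [exact: cvg_cst | exact: sqrt_eps_cvg0].
Unshelve. all: by end_near. Qed.

Lemma metric_run_le k : enorm ((x k.+1 - x k) *m H k) <= gu * d k.
Proof. exact: psd_norm_le (H_posdef k) (H_bounds k).2 (ltW gu_gt0). Qed.

Lemma metric_run_cvg0 :
  (fun k => (x k.+1 - x k) *m H k) @ \oo --> (0 : 'rV[R]_n).
Proof.
apply/cvg_enormP.
apply: (squeeze_cvgr (f := fun=> 0) (h := fun k => gu * d k)).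
- by near=> k; rewrite subr0 enorm_ge0 metric_run_le.
- exact: cvg_cst.
- by rewrite -(mulr0 gu); apply: cvgM; [exact: cvg_cst | exact: step_run_cvg0].
Unshelve. all: by end_near. Qed.

(** A cluster point [u], reached along the indices [sigma]. *)
Section Cluster.
Variables (u : 'rV[R]_n) (sigma : nat -> nat).
Hypothesis sigma_ge : forall j, (j <= sigma j)%N.
Hypothesis x_sigma : (x \o sigma) @ \oo --> u.

Let h_continuous v : {for v, continuous h}.
Proof. exact/differentiable_continuous/(h_C1 I).1. Qed.

Lemma cluster_f_le : (f u <= (cs * g u - h u)%:E)%E.
Proof.
apply: (lsc_lim_le (a := fun j => c (sigma j) * g (x (sigma j)) - h (x (sigma j)))
  f_closed x_sigma).
  apply: cvgB; last exact: (continuous_cvg _ (h_continuous (v := u)) x_sigma).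
  apply: cvgM; first exact: (cvg_subsequence sigma_ge c_cvg).
  exact: (continuous_cvg _ (g_cont (x := u)) x_sigma).
move=> j; have [xO xf] := x_dom (sigma j).
rewrite -(fineK (effdom_fin_num f_gtNy xf)) lee_fin.
by rewrite /c /Defs.ratio divfK ?gt_eqF ?g_run_gt0// addrK.
Qed.

Lemma cluster_effdom : effdom f u.
Proof. by apply: le_lt_trans cluster_f_le _; rewrite ltry. Qed.

Lemma cluster_g_gt0 : 0 < g u.
Proof.
rewrite lt_def g_ge0 ?andbT; last exact: cluster_effdom.
apply/negP => /eqP gu0; have := fh_gt0 gu0; have := cluster_f_le.
rewrite gu0 mulr0 sub0r -(fineK (effdom_fin_num f_gtNy cluster_effdom)).
by rewrite -EFinD lee_fin lte_fin; lra.
Qed.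

Lemma cluster_ratio : Defs.ratio f h g u = cs.
Proof.
have [Of [Lf [uO Lf0 fL]]] := f_loclip cluster_effdom.
have fc : fine (f (x (sigma j))) @[j --> \oo] --> fine (f u).
  apply/cvgrPdist_le => e e0 /=.
  have eL : 0 < e / Lf by exact: divr_gt0.
  near=> j.
  have [xO xf] := x_dom (sigma j).
  rewrite distrC; apply: le_trans (fL (x (sigma j)) u _ _) _.
  - split=> //; near: j; exact: x_sigma.
  - by split; [exact: nbhs_singleton | exact: cluster_effdom].
  rewrite mulrC -ler_pdivlMr//; near: j.
  have : nbhs u [set v | enorm (v - u) <= e / Lf].
    by apply/nbhs_enormP; exists (e / Lf) => // v /ltW.
  by move/x_sigma.
have : c (sigma j) @[j --> \oo] --> Defs.ratio f h g u.
  apply: cvgM.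
    by apply: cvgD => //; exact: (continuous_cvg _ (h_continuous (v := u)) x_sigma).
  apply: cvgV; first by rewrite gt_eqF// cluster_g_gt0.
  exact: (continuous_cvg _ (g_cont (x := u)) x_sigma).
move/(cvg_unique _ (cvg_subsequence sigma_ge c_cvg)) => ->//.
Unshelve. all: by end_near. Qed.

(** Late enough indices, at which [xi] is an exact subgradient. *)
Let sigma1 j := sigma (j + K0)%N.

Lemma sigma1_ge j : (j <= sigma1 j)%N.
Proof. exact: leq_trans (leq_addr _ _) (sigma_ge _). Qed.

Lemma x_sigma1 : (x \o sigma1) @ \oo --> u.
Proof. exact: (cvg_subsequence (fun j => leq_addr K0 j) x_sigma). Qed.

Lemma x_sigma1_S : (fun j => x (sigma1 j).+1) @ \oo --> u.
Proof.
have dx : (fun k => x k.+1 - x k) @ \oo --> (0 : 'rV[R]_n).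
  apply/cvg_enormP; have -> : (fun k => enorm (x k.+1 - x k - 0)) = d.
    by apply/funext => k; rewrite subr0.
  exact: step_run_cvg0.
have -> : (fun j => x (sigma1 j).+1)
  = (x \o sigma1) + ((fun k => x k.+1 - x k) \o sigma1).
  by apply/funext => j; rewrite fctE /= addrC subrK.
rewrite -[u]addr0.
exact: (cvgD x_sigma1 (cvg_subsequence sigma1_ge dx)).
Qed.

Lemma cluster_Omega : Omega g u.
Proof. by rewrite /Omega /= gt_eqF// cluster_g_gt0. Qed.

Lemma grad_g_sigma1 : (fun j => grad g (x (sigma1 j))) @ \oo --> grad g u.
Proof. exact: (cvg_comp _ _ x_sigma1 (g_C1 cluster_Omega).2). Qed.

Lemma cluster_subgrad_f : convex_subdiff f u (cs *: grad g u - grad h u).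
Proof.
apply: (convex_subdiff_closed (x := fun j => x (sigma1 j).+1)
  (y := fun j => xi (sigma1 j)) f_proper f_closed x_sigma1_S).
  have -> : (fun j => xi (sigma1 j)) = (fun j =>
      (Delta (sigma1 j) - (x (sigma1 j).+1 - x (sigma1 j)) *m H (sigma1 j))
      + (c (sigma1 j) *: grad g (x (sigma1 j)) - grad h (x (sigma1 j)))).
    apply/funext => j; rewrite DeltaE -/(c _) grad_g_run addrK.
    by rewrite addrA subrK addrK.
  rewrite -(add0r (cs *: grad g u - grad h u)); apply: cvgD.
    rewrite -(subr0 (0 : 'rV[R]_n)).
    exact: (cvg_subsequence sigma1_ge (cvgB Delta_run_cvg0 metric_run_cvg0)).
  apply: cvgB; last exact: (cvg_comp _ _ x_sigma1 (h_C1 I).2).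
  by apply: cvgZ; [exact: (cvg_subsequence sigma1_ge c_cvg) | exact: grad_g_sigma1].
move=> j; have := xi_sub (sigma1 j); rewrite delta_eq0//.
exact: leq_trans (leq_addl _ _) (sigma_ge _).
Qed.

Lemma cluster_subgrad_g : convex_subdiff (EFin \o g) u (grad g u).
Proof.
apply: (convex_subdiff_closed (x := x \o sigma1)
  (y := fun j => grad g (x (sigma1 j)))) x_sigma1 grad_g_sigma1 _.
- by split; [move=> v; rewrite ltNyr | exists u; rewrite /effdom /= ltry].
- move=> v b; rewrite lte_fin => bv.
  exists [set w | b < g w]; last by move=> w; rewrite lte_fin.
  by apply: (cvgr_gt _ (g_cont (x := v))).
- by move=> j; rewrite -grad_g_run; exact: y_sub.
Qed.

Lemma cluster_critical : critical_point f h g u.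
Proof.
have FuE := objF_ratio h cluster_effdom cluster_Omega.
split; first by rewrite /effdom /= FuE ltry.
exists (cs *: grad g u - grad h u), (grad g u); split.
- exact: cluster_subgrad_f.
- exact: cluster_subgrad_g.
- by rewrite FuE /= cluster_ratio subrK subrr.
Qed.

Section KL.
Variable tau : R.
Hypothesis tau_gt1 : 1 < tau.
Hypothesis Phi_KL : KL_function (Phi (objF f h g) tau).
Variables s2 s3 : nat -> R.
Hypothesis s2_ge0 : forall k, 0 <= s2 k.
Hypothesis s2E : forall k, s2 k = Num.sqrt (eps k) + s2 k.+1.
Hypothesis s2_cvg0 : s2 @ \oo --> 0.
Hypothesis s3_ge0 : forall k, 0 <= s3 k.
Hypothesis s3E : forall k, s3 k = s k `^ (1 - tau^-1) + s3 k.+1.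
Hypothesis s3_cvg0 : s3 @ \oo --> 0.

Let tau_gt0 : 0 < tau.
Proof. by have := tau_gt1; lra. Qed.

(** The auxiliary coordinate of the potential, chosen so that
    [t k `^ tau / tau] is the tail [s k] of the tolerances. *)
Let t k := (tau * s k) `^ tau^-1.

Let ts_ge0 k : 0 <= tau * s k.
Proof. by rewrite mulr_ge0 ?(ltW tau_gt0). Qed.

Lemma aux_powR_tau k : t k `^ tau / tau = s k.
Proof.
by rewrite /t -powRrM mulVf ?gt_eqF// powRr1// mulrC mulKf ?gt_eqF.
Qed.

Lemma aux_powR_tau1 k :
  t k `^ (tau - 1) = tau `^ (1 - tau^-1) * s k `^ (1 - tau^-1).
Proof.
by rewrite /t -powRrM mulrBr mulVf ?gt_eqF// mulr1 powRM// ltW.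
Qed.

Lemma aux_cvg0 : t @ \oo --> 0.
Proof.
apply: powR_inv_cvg0 => //; rewrite -(mulr0 tau).
by apply: cvgM => //; exact: cvg_cst.
Qed.

Lemma Phi_run k : Phi (objF f h g) tau (pt (x k) (t k)) = (c k + s k)%:E.
Proof.
have [xO xf] := x_dom k.
by rewrite /Phi lsubmx_pt rsubmx_pt powR_ge0 objF_ratio// aux_powR_tau -EFinD.
Qed.

Lemma Phi_cluster : Phi (objF f h g) tau (pt u 0) = cs%:E.
Proof.
rewrite /Phi lsubmx_pt rsubmx_pt lexx powR0 ?gt_eqF// mul0r adde0.
by rewrite objF_ratio ?cluster_ratio//; [exact: cluster_effdom | exact: cluster_Omega].
Qed.

Lemma frechet_subdiff_run k v xiv : effdom f v -> Omega g v ->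
  convex_subdiff f v xiv ->
  frechet_subdiff (Phi (objF f h g) tau) (pt v (t k))
    (pt (ratio_subgrad f h g v xiv) (t k `^ (tau - 1))).
Proof.
move=> vf vO vsub; apply: frechet_subdiff_Phi => //; last exact: powR_ge0.
- by rewrite lt_def vO g_ge0.
- exact: (h_C1 I).1.
- exact: (g_C1 vO).1.
- exact: g_cont.
Qed.

(** The relative error bound for the subgradients of the potential. *)
Lemma subgrad_run_le : exists rho C : R, [/\ 0 < rho, 0 < C &
  forall k, enorm (x k - u) < rho -> enorm (x k.+1 - u) < rho ->
    enorm (pt (ratio_subgrad f h g (x k.+1) (xi k)) (t k.+1 `^ (tau - 1)))
      <= C * (d k + (Num.sqrt (eps k) + s k.+1 `^ (1 - tau^-1)))].
Proof.
have [rho [m [Lc [Lg [Gm [[rho0 m0 Lc0 Lg0 Gm0] near_u]]]]]] :=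
  ratio_lipschitz_near h_C1 Lh_gt0 h_lip (c 0%N + s 0%N)
    cluster_effdom cluster_g_gt0 g_cont f_loclip grad_g_loclip.
pose Cm := c 0%N + s 0%N.
have Cm0 : 0 <= Cm by rewrite addr_ge0 ?ratio_run_ge0.
pose K1 := Lh + (Cm * Lg + Lc * Gm) + gu.
have K10 : 0 <= K1.
  have := mulr_ge0 Cm0 Lg0; have := mulr_ge0 Lc0 Gm0.
  by rewrite /K1; have := gu_gt0; have := Lh_gt0; lra.
pose T := tau `^ (1 - tau^-1).
have T0 : 0 <= T by exact: powR_ge0.
pose C := (Num.sqrt M + K1) / m + T + 1.
have MK0 : 0 <= (Num.sqrt M + K1) / m.
  by rewrite divr_ge0 ?(ltW m0)// addr_ge0 ?sqrtr_ge0.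
have C0 : 0 < C by rewrite /C; lra.
exists rho, C; split=> // k xk xk1.
have [xO xf] := x_dom k; have [xO1 xf1] := x_dom k.+1.
have gsub j : convex_subdiff (EFin \o g) (x j) (grad g (x j)).
  by rewrite -grad_g_run; exact: y_sub.
have cCm : `|c k| <= Cm by rewrite ger0_norm ?ratio_run_ge0 ?ratio_run_le.
have [gm cc gg gG] := near_u _ _ xk xk1 xf xf1 xO xO1 (gsub k) (gsub k.+1) cCm.
set q := s k.+1 `^ (1 - tau^-1); set e := Num.sqrt (eps k).
have q0 : 0 <= q by exact: powR_ge0.
have e0 : 0 <= e by exact: sqrtr_ge0.
have d0 : 0 <= d k by exact: enorm_ge0.
apply: le_trans (enorm_pt_le _ _) _.
rewrite ger0_norm ?powR_ge0// aux_powR_tau1 -/T -/q.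
suff : enorm (ratio_subgrad f h g (x k.+1) (xi k))
    <= (Num.sqrt M + K1) / m * (d k + e).
  move=> le1.
  have := mulr_ge0 MK0 q0; have := mulr_ge0 T0 (addr_ge0 d0 e0).
  by rewrite /C; lra.
rewrite enormZ normfV (gtr0_norm (g_run_gt0 k.+1)) mulrC.
rewrite ler_pdivrMr ?g_run_gt0//.
apply: (@le_trans _ _ ((Num.sqrt M + K1) * (d k + e))); last first.
  have de0 : 0 <= (Num.sqrt M + K1) * (d k + e).
    by apply: mulr_ge0; apply: addr_ge0 => //; exact: sqrtr_ge0.
  have -> : (Num.sqrt M + K1) / m * (d k + e) * g (x k.+1)
          = (Num.sqrt M + K1) * (d k + e) * (g (x k.+1) / m).
    by field; rewrite gt_eqF.
  by rewrite ler_peMr// ler_pdivlMr// mul1r.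
(* [xi] is eliminated by means of the optimality condition of the subproblem *)
have -> : xi k + grad h (x k.+1) - c k.+1 *: grad g (x k.+1)
  = (Delta k + (grad h (x k.+1) - grad h (x k)))
    - (c k.+1 *: grad g (x k.+1) - c k *: grad g (x k))
    - (x k.+1 - x k) *m H k.
  rewrite DeltaE grad_g_run -/(c k).
  move: (_ *m H k) (c k *: _) (c k.+1 *: _) => w1 w2 w3.
  by apply/rowP => i; rewrite !mxE; ring.
have -> : c k.+1 *: grad g (x k.+1) - c k *: grad g (x k)
  = c k *: (grad g (x k.+1) - grad g (x k)) + (c k.+1 - c k) *: grad g (x k.+1).
  by rewrite scalerBr scalerBl [RHS]addrC addrA subrK.
have b1 := Delta_run_le k; rewrite -/e in b1.
have b2 := h_lip (x k.+1) (x k); rewrite -/(d k) in b2.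
have b3 : enorm (c k *: (grad g (x k.+1) - grad g (x k))) <= Cm * Lg * d k.
  by rewrite enormZ -mulrA; apply: ler_pM; rewrite ?enorm_ge0.
have b4 : enorm ((c k.+1 - c k) *: grad g (x k.+1)) <= Lc * Gm * d k.
  by rewrite enormZ mulrAC; apply: ler_pM; rewrite ?enorm_ge0.
have b5 := metric_run_le k.
apply: le_trans (enormBD _ _) _.
have := enormBD (Delta k + (grad h (x k.+1) - grad h (x k)))
  (c k *: (grad g (x k.+1) - grad g (x k)) + (c k.+1 - c k) *: grad g (x k.+1)).
have := enormD (Delta k) (grad h (x k.+1) - grad h (x k)).
have := enormD (c k *: (grad g (x k.+1) - grad g (x k)))
  ((c k.+1 - c k) *: grad g (x k.+1)).
have := mulr_ge0 K10 e0; have := mulr_ge0 (sqrtr_ge0 M) d0.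
by rewrite /K1; lra.
Qed.

Lemma run_cvg : x @ \oo --> u.
Proof.
have [_ _ KL] := Phi_KL.
have limnon : limiting_subdiff (Phi (objF f h g) tau) (pt u 0) !=set0.
  exists (pt (ratio_subgrad f h g u (cs *: grad g u - grad h u)) (0 `^ (tau - 1))).
  apply: frechet_sub_limiting; apply: frechet_subdiff_Phi => //.
  - exact: cluster_effdom.
  - exact: cluster_g_gt0.
  - exact: (h_C1 I).1.
  - exact: (g_C1 cluster_Omega).1.
  - exact: g_cont.
  - exact: cluster_subgrad_f.
have [nu [V [phi [nu0 uV des klP]]]] := KL _ limnon.
have [rho1 rho10 rho1V] := (nbhs_enormP _ _).1 uV.
have [rho2 [C [rho20 C0 subP]]] := subgrad_run_le.
have rho12 : 0 < rho1 / 2 by rewrite divr_gt0.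
pose rho := Num.min (rho1 / 2) rho2.
have rho0 : 0 < rho by rewrite lt_min rho12.
have [N1 _ N1P] : \forall k \near \oo, t k < rho1 / 2.
  exact: (cvgr_lt _ aux_cvg0 _ rho12).
have [N2 _ N2P] : \forall k \near \oo, ((E k)%:E < nu)%E.
  move: nu0; case: (nu) => [r| |//]; last first.
    by move=> _; near=> k; rewrite ltry.
  rewrite lte_fin => r0; near=> k; rewrite lte_fin; near: k.
  exact: (cvgr_lt _ gap_cvg0 _ r0).
have Ca0 : 0 <= C / a by rewrite divr_ge0 ?ltW.
pose N0 := maxn K0 (maxn N1 N2).
apply: (capture_cvg (rho := rho) (N0 := N0) (P := fun k => C / a * phi (E k))
  (r := fun k => Num.sqrt (eps k) + s k.+1 `^ (1 - tau^-1))
  (s := fun k => s2 k + s3 k.+1) sigma_ge x_sigma rho0).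
- move=> k; rewrite !geq_max => /and3P[_ _ /N2P kN].
  apply: mulr_ge0 => //; have [_ _ phi0 _ _] := des; apply: phi0 => //.
  exact: gap_ge0.
- rewrite -(mulr0 (C / a)); apply: cvgM; first exact: cvg_cst.
  exact: desingularizing_cvg0 des gap_ge0 gap_cvg0.
- by move=> k; exact: addr_ge0.
- by move=> k; rewrite (s2E k) (s3E k.+1); ring.
- rewrite -(addr0 (0 : R)); apply: cvgD => //.
  exact: (cvg_subsequence leqnSn s3_cvg0).
- exact: step_run_cvg0.
move=> k; rewrite !geq_max => /and3P[kK kN1 kN2].
rewrite !lt_min => /andP[xk1 xk2] /andP[xk11 xk12].
have tk : t k.+1 < rho1 / 2 by apply: N1P => /=; exact: leqW.
have Ek : ((E k.+1)%:E < nu)%E by apply: N2P => /=; exact: leqW.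
have dec := gap_decrease k.+1; rewrite -!/(E _) in dec.
have Edec : E k.+2 <= E k.+1.
  by rewrite -subr_ge0; apply: le_trans dec; rewrite mulr_ge0 ?sqr_ge0// ltW.
apply: (kl_step des a_gt0 C0 (gap_ge0 k.+2) Edec Ek (enorm_ge0 _) (enorm_ge0 _)
  _ dec (subP k xk2 xk12)); first by rewrite addr_ge0 ?sqrtr_ge0 ?powR_ge0.
move=> Ek0.
have zV : V (pt (x k.+1) (t k.+1)).
  apply: rho1V; rewrite ptB; apply: le_lt_trans (enorm_pt_le _ _) _.
  rewrite subr0 ger0_norm ?powR_ge0//; lra.
(* the KL inequality at [(x k.+1, t k.+1)], whose potential exceeds [cs] by
   [E k.+1] *)
have := klP _ zV; rewrite Phi_run Phi_cluster lte_fin.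
have [_ _ _ _ dphi] := des; have [_ _ dphi0] := dphi _ Ek0 Ek.
have gap0 : cs < c k.+1 + s k.+1 by move: Ek0; rewrite /E subr_gt0.
have gapnu : ((c k.+1 + s k.+1)%:E < cs%:E + nu)%E.
  move: Ek; rewrite /E; case: (nu) => [r| |].
  - by rewrite -EFinD !lte_fin ltrBlDl.
  - by move=> _; rewrite addey// ltry.
  - by rewrite ltNge leNye.
move=> /(_ gap0 gapnu) /= kl.
rewrite -lee_fin EFinM; apply: le_trans kl _.
rewrite lee_pmul2l ?lte_fin//; apply: dist0_le.
have [xO1 xf1] := x_dom k.+1; apply: frechet_subdiff_run => //.
by have := xi_sub k; rewrite delta_eq0.
Unshelve. all: by end_near. Qed.

End KL.
End Cluster.
End Limit.
End Run.

Theorem theorem4p1 (R : realType) (n : nat)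
  (f : 'rV[R]_n -> \bar R) (h g : 'rV[R]_n -> R) (Lh : R)
  (Omega_nonempty : Omega g !=set0)
  (* (A1) *)
  (f_proper : eproper f)
  (f_closed : lower_semicontinuous f)
  (f_convex : econvex f)
  (* (A2) *)
  (h_C1 : C1_on setT h)
  (Lh_gt0 : 0 < Lh)
  (h_lip : forall x y, enorm (grad h x - grad h y) <= Lh * enorm (x - y))
  (* (A3) *)
  (g_cont : continuous g)
  (g_convex : convex_function (E := 'rV[R]_n) setT g)
  (g_ge0 : forall x, effdom f x -> 0 <= g x)
  (* (A4) *)
  (fh_ge0 : forall x, effdom f x -> (0 <= f x + (h x)%:E)%E)
  (fh_gt0 : forall x, g x = 0 -> (0 < f x + (h x)%:E)%E)
  (* (A5) *)
  (F_level_bounded : level_bounded (objF f h g))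
  (* (1) *)
  (f_loclip : locally_lipschitz_on_dom f)
  (* (2) *)
  (g_C1 : C1_on (Omega g) g)
  (grad_g_loclip : locally_lipschitz_on (Omega g) (grad g))
  (* (3) *)
  (eps : nat -> R) (H : nat -> 'M[R]_n)
  (x y Delta : nat -> 'rV[R]_n) (delta : nat -> R)
  (x_run : iVPGSA f h g eps H x y Delta delta)
  (delta_eq0 : exists2 K0 : nat, (0 < K0)%N &
                 forall k, (K0 <= k)%N -> delta k = 0)
  (* (4) *)
  (H_bounds : exists gl gu : R,
      [/\ 0 < gl, 0 < gu, Lh / 2 < gl, gl <= gu &
          forall k, loewner_le gl%:M (H k) /\ loewner_le (H k) gu%:M])
  (tau : R) (tau_gt1 : 1 < tau)
  (Phi_KL : KL_function (Phi (objF f h g) tau))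
  (sum_eps : (\sum_(0 <= k <oo) (eps k)%:E < +oo)%E)
  (sum_sqrt_eps : (\sum_(0 <= k <oo) (Num.sqrt (eps k))%:E < +oo)%E)
  (sum_tails : (\sum_(0 <= k <oo)
      ((\sum_(k <= i <oo) (eps i)%:E) `^ (1 - tau^-1)%R) < +oo)%E) :
  exists2 xs : 'rV[R]_n, x @ \oo --> xs & critical_point f h g xs.
Proof.
have [eps_ge0 H_pd x_dom y_sub step] := x_run.
have [K0 _ delta0] := delta_eq0.
have [gl [gu [_ gu0 Lh_gl _ HB]]] := H_bounds.
have /choice[xi xiP] : forall k, exists xi, eps_subdiff (delta k) f (x k.+1) xi /\
    Delta k = xi + grad h (x k) - Defs.ratio f h g (x k) *: y k
              + (x k.+1 - x k) *m H k.
  by move=> k; have [_ [xi ? ?] _] := step k; exists xi.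
have xi_sub k := (xiP k).1; have DE k := (xiP k).2.
have delta_ge0 k : 0 <= delta k by have [] := step k.
have err k : enorm (Delta k) ^+ 2 + `|dot (Delta k) (x k.+1 - x k)| + delta k
  <= eps k * g (x k.+1) by have [] := step k.
have [s [sS s_ge0 sE s0]] := summable_tail eps_ge0 sum_eps.
have [s2 [_ s2_ge0 s2E s20]] := summable_tail (fun k => sqrtr_ge0 (eps k)) sum_sqrt_eps.
have [s3 [_ s3_ge0 s3E s30]] : exists s3 : nat -> R,
    [/\ forall k, (\sum_(k <= i <oo) (s i `^ (1 - tau^-1))%:E)%E = (s3 k)%:E,
        forall k, 0 <= s3 k,
        forall k, s3 k = s k `^ (1 - tau^-1) + s3 k.+1 & s3 @ \oo --> 0].
  apply: summable_tail; first by move=> k; exact: powR_ge0.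
  by under eq_eseriesr do rewrite -poweR_EFin -sS.
have bnd := run_bounded f_proper h_C1 Lh_gt0 h_lip g_ge0 fh_ge0 F_level_bounded
  x_dom y_sub xi_sub DE err Lh_gl HB s_ge0 sE.
have [cs [M [a [[M0 a0 gM] c_cvg gap_ge0 gap0 gap_dec]]]] :=
  merit_run_limit f_proper h_C1 Lh_gt0 h_lip g_cont g_ge0 fh_ge0 F_level_bounded
  x_dom y_sub xi_sub DE err Lh_gl HB s_ge0 sE s0.
have [u [sigma [sigma_ge x_sigma]]] := bounded_seq_cluster bnd.
exists u.
  exact: (run_cvg f_proper f_closed h_C1 Lh_gt0 h_lip g_cont g_ge0 fh_ge0 fh_gt0
    f_loclip g_C1 grad_g_loclip eps_ge0 H_pd x_dom y_sub delta_ge0 xi_sub DE err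
    delta0 gu0 Lh_gl HB s_ge0 sE s0 M0 a0 gM c_cvg gap_ge0 gap0 gap_dec
    sigma_ge x_sigma tau_gt1 Phi_KL s2_ge0 s2E s20 s3_ge0 s3E s30).
exact: (cluster_critical f_proper f_closed h_C1 g_cont g_ge0 fh_gt0 f_loclip
  g_C1 eps_ge0 H_pd x_dom y_sub delta_ge0 xi_sub DE err delta0 gu0 HB sE s0
  M0 a0 gM c_cvg gap0 gap_dec sigma_ge x_sigma).
Qed.
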